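(* Let $\mathbb{V}=(V_1,\dots,V_n)$ be a completely non-unitary $n$-tuple of commuting isometries on a Hilbert space $\mathcal{H}$, and suppose $Z(\operatorname{Ann}(\mathbb{V}))$ has dimension $1$. There is a subset $\mathcal{F}\subseteq (\{0\}\cup\mathbb{T})^n$ and a collection of non-zero $\mathbb{V}$-reducing subspaces $(\mathcal{H}_z)_{z\in\mathcal{F}}$ such that $\mathcal{H}=\bigoplus_{z\in\mathcal{F}}\mathcal{H}_z$ (orthogonal direct sum), and for each $z=(z_1,\dots,z_n)\in\mathcal{F}$ the following hold. (1) If $i\in\{1,\dots,n\}$ and $z_i=0$, then $V_i|\mathcal{H}_z$ is a shift. If $z_i\neq 0$, then $(V_i-z_i I)|\mathcal{H}_z=0$. (2) Suppose exactly $s$ components of $z$ are $0$, and let $\lambda_{s+1},\dots,\lambda_n$ denote the non-zero components of $z$. After a permutation of coordinates, there is a distinguished variety $\mathcal{W}\subseteq \mathbb{C}^s$ of pure dimension $1$ such that $$Z(\operatorname{Ann}(\mathbb{V}|\mathcal{H}_z))=\mathcal{W}\times\{(\lambda_{s+1},\dots,\lambda_n)\}.$$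
   Context: Hilbert spaces are complex and subspaces are closed. For an $n$-tuple $\mathbb{V}$ of commuting isometries, $\operatorname{Ann}(\mathbb{V})=\{p\in\mathbb{C}[X_1,\dots,X_n]:p(V_1,\dots,V_n)=0\}$. A subspace $\mathcal{K}$ is $\mathbb{V}$-reducing if it is reducing for every $V_i$; then $\mathbb{V}|\mathcal{K}=(V_1|\mathcal{K},\dots,V_n|\mathcal{K})$. $\mathbb{V}$ is completely non-unitary if there is no non-zero $\mathbb{V}$-reducing subspace $\mathcal{K}$ such that $V_i|\mathcal{K}$ is unitary for every $i$. For a set $S$ of polynomials, $Z(S)\subseteq\mathbb{C}^n$ is the common zero set, and dimension is that of a complex algebraic variety; pure dimension $1$ means every irreducible component has dimension $1$. An operator $V$ on a Hilbert space $\mathcal{K}$ is a shift if it is an isometry with $\bigcap_{j=0}^\infty V^j\mathcal{K}=\{0\}$. A variety $\mathcal{W}\subseteq\mathbb{C}^k$ is distinguished if $\mathcal{W}\subseteq\mathbb{D}^k\cup\mathbb{T}^k\cup\mathbb{E}^k$, where $\mathbb{D}$ is the open unit disc, $\mathbb{T}$ the unit circle, $\mathbb{E}$ the exterior of the closed unit disc in $\mathbb{C}$. The permutation of coordinates in (2) (depending on $z$) moves the zero components of $z$ to the first $s$ positions. *)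

(* Defs.v *)
From HB Require Import structures.
From mathcomp Require Import all_boot all_order all_algebra.
From mathcomp Require Import complex.
From mathcomp Require Import all_classical all_reals all_analysis.
(* Not imported: its notations clash with those of MathComp-Analysis. *)
From mathcomp.multinomials Require mpoly.

Set Implicit Arguments.
Unset Strict Implicit.
Unset Printing Implicit Defensive.

Import Order.TTheory GRing.Theory Num.Theory.
Import numFieldNormedType.Exports.

Local Open Scope classical_set_scope.
Local Open Scope ring_scope.

(** Affine varieties in C^n; points of C^n are functions ['I_n -> C]. *)

Definition zero_set (C : numClosedFieldType) (n : nat)
    (S : set (mpoly.mpoly n C)) : set ('I_n -> C) :=
  [set x | forall p, S p -> mpoly.meval x p = 0].

Definition variety (C : numClosedFieldType) (n : nat) (X : set ('I_n -> C)) :=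
  exists S : set (mpoly.mpoly n C), X = zero_set S.

Definition irreducible_variety (C : numClosedFieldType) (n : nat)
    (X : set ('I_n -> C)) :=
  [/\ variety X, X !=set0 &
    forall Y1 Y2 : set ('I_n -> C), variety Y1 -> variety Y2 ->
      X `<=` Y1 `|` Y2 -> X `<=` Y1 \/ X `<=` Y2].

Definition irreducible_component (C : numClosedFieldType) (n : nat)
    (X Y : set ('I_n -> C)) :=
  [/\ irreducible_variety Y, Y `<=` X &
    forall Y' : set ('I_n -> C), irreducible_variety Y' -> Y' `<=` X ->
      Y `<=` Y' -> Y' = Y].

(* A chain c_0 < c_1 < ... < c_d of irreducible subvarieties of X. *)
Definition irreducible_chain (C : numClosedFieldType) (n : nat)
    (X : set ('I_n -> C)) (d : nat) :=
  exists c : nat -> set ('I_n -> C),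
    (forall k, (k <= d)%N -> irreducible_variety (c k) /\ c k `<=` X) /\
    (forall k, (k < d)%N -> c k `<` c k.+1).

(* Krull dimension of a variety for the Zariski topology. *)
Definition has_dimension (C : numClosedFieldType) (n : nat)
    (X : set ('I_n -> C)) (d : nat) :=
  irreducible_chain X d /\ ~ irreducible_chain X d.+1.

Definition has_pure_dimension (C : numClosedFieldType) (n : nat)
    (X : set ('I_n -> C)) (d : nat) :=
  forall Y, irreducible_component X Y -> has_dimension Y d.

Definition distinguished_variety (C : numClosedFieldType) (n : nat)
    (X : set ('I_n -> C)) :=
  variety X /\
  X `<=` [set x | forall i, `|x i| < 1] `|` [set x | forall i, `|x i| = 1]
         `|` [set x | forall i, 1 < `|x i|].

(* The product W x {lambda} in C^(s + t) = C^s x C^t. *)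
Definition times_point (C : numClosedFieldType) (s t : nat)
    (W : set ('I_s -> C)) (lambda : 'I_t -> C) : set ('I_(s + t) -> C) :=
  [set x | W (fun i => x (lshift t i)) /\
           forall j, x (rshift s j) = lambda j].

(** Hilbert spaces. A complex Hilbert space is a complete normed space [H]
    over [R[i]] whose norm comes from an inner product [dot]. *)

Definition norm_from_dot (R : realType) (H : completeNormedModType R[i])
    (dot : {dot H for Num.conj}) :=
  forall x : H, `|x| ^+ 2 = dot x x.

Definition closed_subspace (R : realType) (H : completeNormedModType R[i])
    (K : set H) :=
  closed K /\ submod_closed (mem K).

Definition orthocomplement (R : realType) (H : completeNormedModType R[i])
    (dot : {dot H for Num.conj}) (K : set H) : set H :=
  [set x | forall y, K y -> dot x y = 0].

Definition reducing_for (R : realType) (H : completeNormedModType R[i])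
    (dot : {dot H for Num.conj}) (T : H -> H) (K : set H) :=
  [/\ closed_subspace K, T @` K `<=` K &
    T @` orthocomplement dot K `<=` orthocomplement dot K].

Definition tuple_reducing (R : realType) (H : completeNormedModType R[i])
    (dot : {dot H for Num.conj}) (n : nat) (V : 'I_n -> {linear H -> H})
    (K : set H) :=
  closed_subspace K /\ forall i, reducing_for dot (V i) K.

(* The predicates [_ T K] below concern the restriction of [T] to a closed
   subspace [K] with [T K <= K]; [K = setT] gives [T] itself. *)

Definition isometry_on (R : realType) (H : completeNormedModType R[i])
    (T : H -> H) (K : set H) :=
  forall x, K x -> `|T x| = `|x|.

Definition unitary_on (R : realType) (H : completeNormedModType R[i])
    (T : H -> H) (K : set H) :=
  isometry_on T K /\ T @` K = K.

Definition shift_on (R : realType) (H : completeNormedModType R[i])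
    (T : H -> H) (K : set H) :=
  isometry_on T K /\ \bigcap_(j in [set: nat]) (iter j T @` K) = [set 0].

Definition commuting_isometries (R : realType) (H : completeNormedModType R[i])
    (n : nat) (V : 'I_n -> {linear H -> H}) :=
  (forall i, isometry_on (V i) setT) /\
  (forall i j x, V i (V j x) = V j (V i x)).

Definition completely_non_unitary (R : realType)
    (H : completeNormedModType R[i]) (dot : {dot H for Num.conj}) (n : nat)
    (V : 'I_n -> {linear H -> H}) :=
  ~ exists K : set H,
    [/\ tuple_reducing dot V K, K <> [set 0] & forall i, unitary_on (V i) K].

(* The operator p(V_1, ..., V_n); the order of the factors in a monomial is
   irrelevant for commuting operators. *)
Definition poly_apply (R : realType) (H : completeNormedModType R[i]) (n : nat)
    (V : 'I_n -> {linear H -> H}) (p : mpoly.mpoly n R[i]) (x : H) : H :=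
  \sum_(m <- mpoly.msupp p)
    mpoly.mcoeff m p *: (\big[comp/idfun]_(i < n) iter (mpoly.fun_of_multinom m i) (V i)) x.

(* Ann(V|K), for K invariant under every V_i. *)
Definition annihilator (R : realType) (H : completeNormedModType R[i])
    (n : nat) (V : 'I_n -> {linear H -> H}) (K : set H) :
    set (mpoly.mpoly n R[i]) :=
  [set p | forall x, K x -> poly_apply V p x = 0].

(* H is the internal Hilbert space direct sum of the subspaces E z, z in F:
   these are pairwise orthogonal and their closed linear span is H. *)
Definition orthogonal_direct_sum (R : realType)
    (H : completeNormedModType R[i]) (dot : {dot H for Num.conj}) (I : Type)
    (F : set I) (E : I -> set H) :=
  (forall z w, F z -> F w -> z <> w ->
     forall x y, E z x -> E w y -> dot x y = 0) /\
  smallest (@closed_subspace R H) (\bigcup_(z in F) E z) = [set: H].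

(* Main.v *)
Require Import Defs.
From HB Require Import structures.
From mathcomp Require Import all_boot all_order all_algebra.
From mathcomp Require Import complex ring lra polyXY.
From mathcomp Require Import all_classical all_reals all_analysis.
From mathcomp.multinomials Require mpoly ssrcomplements.
Import -(notations) mpoly.

Set Implicit Arguments.
Unset Strict Implicit.
Unset Printing Implicit Defensive.

Import Order.TTheory GRing.Theory Num.Theory.
Import numFieldNormedType.Exports.

Local Open Scope classical_set_scope.
Local Open Scope ring_scope.

(** Decomposition. An eigenspace of an isometry [V i] for an eigenvalue of
    modulus 1 reduces every operator that commutes with [V i]
    ([adjoint_preserves_eigenvectors]). For [z] with entries 0 or of modulus 1,
    let [joint_part z] consist of the vectors on which [V i] is the scalar
    [z i] when [z i <> 0], and which are orthogonal to all eigenvectors of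
    [V i] when [z i = 0]. These parts reduce the tuple and are pairwise
    orthogonal. They span: any non-zero reducing subspace can be cut down,
    one index at a time, to an eigenspace of [V i] if there is one, and so
    meets a joint part ([joint_part_meets]).

    Relations. As the zero set has dimension 1, any two coordinates satisfy a
    non-zero polynomial relation [q (V i, V j) = 0] ([coordinates_dependent]);
    otherwise a prime ideal over the annihilator that contains no relation
    between [x_i] and [x_j] would start a chain of three irreducible sets. This
    rests on the extension of points along a prime ideal
    ([extend_one_variable], [extend_base_point]) and its special case, the
    Nullstellensatz.

    Shifts. Let [z i = 0] and let [M] be the unitary part of [V i] in
    [joint_part z]. A relation [c (V i) + V j q' (V i, V j) = 0] with [c <> 0]
    shows that the range of [V j] contains that of [c (V i)], which is dense in
    [M] because the unitary [V i] has no eigenvectors there. So every [V j] is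
    unitary on [M], and complete non-unitarity gives [M = 0]
    ([joint_part_pure]).

    Distinguished varieties. Let [X], [Y] be commuting shifts with a relation
    [h (X, Y) = 0], and let [|a| < 1 <= |b|]. The claim is that some relation
    does not vanish at [(a, b)]. On the invariant subspace [M] generated by
    finitely many vectors, [X] has a wandering subspace with a finite basis
    [e_i]. Choose [beta] in the disc with [h (a, beta) <> 0] and write
    [h (x, y) = p (x) + (y - beta) h1 (x, y)]. Then [G = - h1 (X, Y)] satisfies
    [(Y - beta) G = p (X)], and, since [Y] is isometric, [G] maps each [e_i]
    into finitely many levels [X^k e_j]: it is a matrix of polynomials in [X].
    Hence the determinant of [(y - beta) G (x) - p (x)] is a relation on [M].
    It is non-zero at [(a, b)], because [Y - b] is injective modulo
    [(X - a) M] ([determinant_relation]). Finitely many vectors suffice for all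
    of the space: relations of minimal degree in [y] stop growing
    ([generic_finite_set], [pair_no_mixed_zero]). Exchanging [X] and [Y], and
    reflecting relations in the torus as for the adjoint of a polynomial in
    unitaries, excludes the other mixed regions ([pair_regions]).

    Dimension. The variety of a joint part embeds in that of the whole tuple,
    so it has no chain of length 2. It has no isolated points: a shift [V i]
    has no eigenvectors, so [x_i - y_i] is not a zero divisor modulo the
    annihilator, and some prime over the annihilator lies strictly inside the
    ideal of the point [y] ([not_isolated_point]). *)


(** * Prime ideals *)

Section Ideals.
Variable A : comNzRingType.
Implicit Types (I J P S : set A).

Definition is_ideal I :=
  [/\ I 0, forall a b, I a -> I b -> I (a + b) & forall a b, I b -> I (a * b)].

Definition is_prime_ideal P :=
  [/\ is_ideal P, ~ P 1 & forall a b, P (a * b) -> P a \/ P b].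

Definition multiplicative_set S := S 1 /\ forall a b, S a -> S b -> S (a * b).

Lemma ideal0 I : is_ideal I -> I 0.
Proof. by case. Qed.

Lemma idealD I a b : is_ideal I -> I a -> I b -> I (a + b).
Proof. by case=> _ + _; apply. Qed.

Lemma idealMl I a b : is_ideal I -> I b -> I (a * b).
Proof. by case=> _ _; apply. Qed.

Lemma idealMr I a b : is_ideal I -> I a -> I (a * b).
Proof. by rewrite mulrC; exact: idealMl. Qed.

Lemma idealN I a : is_ideal I -> I a -> I (- a).
Proof. by move=> iI Ia; rewrite -mulN1r; apply: idealMl. Qed.

Lemma idealB I a b : is_ideal I -> I a -> I b -> I (a - b).
Proof. by move=> iI Ia Ib; apply: idealD => //; apply: idealN. Qed.

Lemma ideal_sum I (T : Type) (r : seq T) (Q : pred T) (F : T -> A) :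
  is_ideal I -> (forall i, Q i -> I (F i)) -> I (\sum_(i <- r | Q i) F i).
Proof. by move=> iI IF; apply: big_ind => //; [case: iI|move=> *; apply: idealD]. Qed.

Lemma primeX P a k : is_prime_ideal P -> P (a ^+ k) -> P a.
Proof.
case=> iP P1 PM; elim: k => [|k IHk]; first by rewrite expr0.
by rewrite exprS => /PM[].
Qed.

Lemma is_ideal_add_principal I a :
  is_ideal I -> is_ideal [set x | exists2 y, I y & exists z, x = y + z * a].
Proof.
move=> iI; split.
- by exists 0; [case: iI|exists 0; rewrite mul0r addr0].
- move=> _ _ [y Iy [z ->]] [y' Iy' [z' ->]]; exists (y + y'); first exact: idealD.
  by exists (z + z'); rewrite mulrDl addrACA.
- move=> b _ [y Iy [z ->]]; exists (b * y); first exact: idealMl.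
  by exists (b * z); rewrite mulrDr mulrA.
Qed.

(** An ideal that is maximal among those that miss a multiplicative set is
    prime: two elements outside it generate with it two ideals that meet the
    set, and the product of the two meeting points lies in it again. *)
Lemma prime_avoiding J S : is_ideal J -> multiplicative_set S ->
    (forall x, J x -> ~ S x) ->
  exists P, [/\ is_prime_ideal P, J `<=` P & forall x, P x -> ~ S x].
Proof.
move=> iJ [S1 SM] JS.
(* The empty chain has an empty union, hence the union with J. *)
pose good (X : set A) := is_ideal (X `|` J) /\ forall x, (X `|` J) x -> ~ S x.
have [X [[iX XS] Xmax]] : exists X, good X /\ forall B, X `<` B -> ~ good B.
  apply: Zorn_bigcup => F Fgood Ftot; split; last first.
    by move=> x [[Y FY Yx]|]; [have [_] := Fgood _ FY; apply; left|exact: JS].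
  have up Y x : F Y -> (Y `|` J) x -> (\bigcup_(X in F) X `|` J) x.
    by move=> FY [Yx|]; [left; exists Y|right].
  have addF Y a b : F Y -> (Y `|` J) a -> (Y `|` J) b ->
      (\bigcup_(X in F) X `|` J) (a + b).
    by move=> FY Ya Yb; apply: (up Y) => //; have [iY _] := Fgood _ FY; apply: idealD.
  split.
  - by right; case: iJ.
  - move=> a b [[Y FY Ya]|Ja] [[Z FZ Zb]|Jb].
    + have [YZ|ZY] := Ftot _ _ FY FZ.
        by apply: (addF Z) => //; left => //; apply: YZ.
      by apply: (addF Y) => //; left => //; apply: ZY.
    + by apply: (addF Y) => //; [left|right].
    + by apply: (addF Z) => //; [right|left].
    + by right; apply: idealD.
  - move=> a b [[Y FY Yb]|Jb]; last by right; apply: idealMl.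
    by apply: (up Y) => //; have [iY _] := Fgood _ FY; apply: idealMl => //; left.
exists (X `|` J); split; [|by move=> x Jx; right|exact: XS].
have adj a : ~ (X `|` J) a -> exists2 y, (X `|` J) y & exists z, S (y + z * a).
  move=> Pa; apply: contrapT => noS.
  pose B := [set x | exists2 y, (X `|` J) y & exists z, x = y + z * a].
  have PB : X `|` J `<=` B by move=> y Py; exists y => //; exists 0; rewrite mul0r addr0.
  have BJ : B `|` J = B.
    by apply/seteqP; split=> x; [case=> // Jx; apply: PB; right|left].
  apply: (Xmax B).
    split; first by move=> x Xx; apply: PB; left.
    move=> BX; apply: Pa; left; apply: BX.
    by exists 0; [case: iX|exists 1; rewrite mul1r add0r].
  split; first by rewrite BJ; apply: is_ideal_add_principal.
  by rewrite BJ => x [y Py [z ->]] Sx; apply: noS; exists y => //; exists z.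
split=> //; first by move=> /XS.
move=> a b Pab; apply: contrapT => /not_orP[Pa Pb].
have [y Py [z Sa]] := adj _ Pa; have [y' Py' [z' Sb]] := adj _ Pb.
have /XS := SM _ _ Sa Sb; apply => //.
rewrite mulrDl; apply: idealD => //; first exact: idealMr.
rewrite mulrDr; apply: idealD => //; first exact: idealMl.
by rewrite mulrACA; apply: idealMl.
Qed.

End Ideals.

(** * Extending points along a prime ideal *)

Section OneVariable.
Variables (A : comNzRingType) (C : numClosedFieldType).
Variable Q : set {poly A}.
Hypothesis Q_prime : is_prime_ideal Q.
Implicit Types (g h v w : {poly A}).

Let iQ : is_ideal Q. Proof. by case: Q_prime. Qed.

(** The extension to [A[X]] of the contraction of [Q] to [A]. *)
Definition coefs_in h := forall i, Q (h`_i)%:P.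

Lemma coefs_in_sub h : coefs_in h -> Q h.
Proof.
move=> hQ; rewrite -[h]coefK poly_def; apply: ideal_sum => // i _.
by rewrite -mul_polyC; apply: idealMr.
Qed.

Lemma coefs_inD g h : coefs_in g -> coefs_in h -> coefs_in (g + h).
Proof. by move=> Hg Hh i; rewrite coefD polyCD; apply: idealD. Qed.

Lemma coefs_inM g h : coefs_in h -> coefs_in (g * h).
Proof.
move=> Hh i; rewrite coefM rmorph_sum; apply: ideal_sum => // j _.
by rewrite rmorphM; apply: idealMl => //; apply: Hh.
Qed.

(** Modulo the contraction of [Q], either [h] vanishes or it has a genuine
    leading coefficient, one outside [Q]. *)
Lemma drop_leading_coefs h : coefs_in h \/
  exists h', [/\ ~ Q (lead_coef h')%:P, (size h' <= size h)%N & coefs_in (h - h')].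
Proof.
elim: (size h) {-2}h (leqnn (size h)) => [|n IHn] {}h hn.
  by left; move: hn; rewrite leqn0 size_poly_eq0 => /eqP-> i; rewrite coef0 polyC0;
    apply: ideal0.
have [Ql|nQl] := pselect (Q (lead_coef h)%:P); last first.
  by right; exists h; split=> //; move=> i; rewrite subrr coef0 polyC0; apply: ideal0.
have [->|h0] := eqVneq h 0; first by left=> i; rewrite coef0 polyC0; apply: ideal0.
pose h1 := h - (lead_coef h) *: 'X^((size h).-1).
have lX : coefs_in ((lead_coef h) *: 'X^((size h).-1)).
  by move=> i; rewrite coefZ polyCM; apply: idealMr.
have hs : (0 < size h)%N by rewrite lt0n size_poly_eq0.
have h1s : (size h1 < size h)%N.
  rewrite -(prednK hs) ltnS; apply/leq_sizeP => j jh.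
  rewrite coefB coefZ coefXn; have [->|ne] := eqVneq j (size h).-1.
    by rewrite mulr1 subrr.
  rewrite mulr0 subr0 nth_default //.
  by move: jh ne; rewrite leq_eqVlt eq_sym => /orP[->//|]; rewrite (prednK hs).
have h1n : (size h1 <= n)%N by rewrite -ltnS (leq_trans h1s).
have [H|[h' [H1 H2 H3]]] := IHn h1 h1n.
  by left; rewrite -[h](subrK ((lead_coef h) *: 'X^((size h).-1))); apply: coefs_inD.
right; exists h'; split=> //; first by rewrite (leq_trans H2) // ltnW.
have -> : h - h' = (h1 - h') + (lead_coef h) *: 'X^((size h).-1).
  by rewrite /h1 addrAC subrK.
exact: coefs_inD.
Qed.

Lemma minimal_size (U : set {poly A}) : (exists h, U h) ->
  exists2 h, U h & forall h', U h' -> (size h <= size h')%N.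
Proof.
move=> [h0 Uh0]; pose pr n := `[< exists2 h, U h & size h = n >].
have : exists n, pr n by exists (size h0); apply/asboolP; exists h0.
case/ex_minnP => n /asboolP[h Uh <-] hmin; exists h => // h' Uh'.
by apply: hmin; apply/asboolP; exists h'.
Qed.


(** The polynomial [g] of least degree in [Q] with leading coefficient outside
    the contraction of [Q] plays the role of a minimal polynomial: where its
    leading coefficient survives, its roots are the points above a point of
    the base. The ideal generated by [Q] and [v] contains a constant outside
    [Q], which keeps [v] from vanishing at these roots. *)
Lemma extend_one_variable v : ~ Q v -> exists2 u, ~ Q u%:P &
  forall phi : {rmorphism A -> C}, (forall a, Q a%:P -> phi a = 0) -> phi u != 0 ->
  exists2 d, forall h, Q h -> (map_poly phi h).[d] = 0 & (map_poly phi v).[d] != 0.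
Proof.
move=> Qv; have Q1 : ~ Q 1 by case: Q_prime.
have QM a b : Q (a * b) -> Q a \/ Q b by case: Q_prime => _ _; apply.
have coefs0 (phi : {rmorphism A -> C}) h :
    (forall a, Q a%:P -> phi a = 0) -> coefs_in h -> map_poly phi h = 0.
  by move=> phiQ Hh; apply/polyP => i; rewrite coef_map coef0; apply: phiQ.
have [Qc|nQc] := pselect (forall h, Q h -> coefs_in h).
  have [/coefs_in_sub//|[v' [Ql _ vv']]] := drop_leading_coefs v.
  exists (lead_coef v') => // phi phiQ phil.
  have phiv : map_poly phi v != 0.
    rewrite -[v](subrK v') rmorphD /= (coefs0 phi (v - v')) // add0r.
    apply: contraNneq phil => /polyP/(_ (size v').-1).
    by rewrite coef_map coef0 => /eqP.
  have /closed_nonrootP[d rd] := phiv; exists d => // h /Qc Hh.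
  by rewrite coefs0 // horner0.
have [g [Qg gl] gmin] : exists2 g, Q g /\ ~ Q (lead_coef g)%:P &
    forall g', Q g' /\ ~ Q (lead_coef g')%:P -> (size g <= size g')%N.
  apply: minimal_size; apply: contrapT => no; apply: nQc => h Qh.
  have [//|[h' [H1 _ H3]]] := drop_leading_coefs h; case: no; exists h'; split=> //.
  by rewrite -(subKr h h'); apply: idealB => //; apply: coefs_in_sub.
have g_small h : Q h -> (size h < size g)%N -> coefs_in h.
  move=> Qh hg; have [//|[h' [H1 H2 H3]]] := drop_leading_coefs h.
  have : (size g <= size h')%N.
    by apply: gmin; split=> //; rewrite -(subKr h h'); apply: idealB => //;
      apply: coefs_in_sub.
  by rewrite leqNgt (leq_ltn_trans H2 hg).
pose I w := exists a q, Q q /\ w = a * v + q.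
have QI w : Q w -> I w by exists 0, w; rewrite mul0r add0r.
have ID w w' : I w -> I w' -> I (w + w').
  move=> [a [q [Qq ->]]] [a' [q' [Qq' ->]]]; exists (a + a'), (q + q').
  by rewrite mulrDl addrACA; split=> //; apply: idealD.
have IM b w : I w -> I (b * w).
  move=> [a [q [Qq ->]]]; exists (b * a), (b * q).
  by rewrite mulrDr mulrA; split=> //; apply: idealMl.
have IN w : I w -> I (- w) by rewrite -mulN1r; apply: IM.
have [w [Iw wl] wmin] : exists2 w, I w /\ ~ Q (lead_coef w)%:P &
    forall w', I w' /\ ~ Q (lead_coef w')%:P -> (size w <= size w')%N.
  apply: minimal_size; have [/coefs_in_sub//|[v' [H1 _ H3]]] := drop_leading_coefs v.
  exists v'; split=> //; rewrite -(subKr v v'); apply: ID.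
    by exists 1, 0; rewrite mul1r addr0; split=> //; apply: ideal0.
  by apply/IN/QI/coefs_in_sub.
have w_small h : I h -> (size h < size w)%N -> Q h.
  move=> Ih hw; apply: coefs_in_sub.
  have [//|[h' [H1 H2 H3]]] := drop_leading_coefs h.
  have : (size w <= size h')%N.
    apply: wmin; split=> //; rewrite -(subKr h h'); apply: ID => //.
    by apply/IN/QI/coefs_in_sub.
  by rewrite leqNgt (leq_ltn_trans H2 hw).
have w0 : w != 0 by apply: contra_notN wl => /eqP->; rewrite lead_coef0 polyC0; apply: ideal0.
have g0 : g != 0 by apply: contra_notN gl => /eqP->; rewrite lead_coef0 polyC0; apply: ideal0.
(* Pseudo-division by [w]: by minimality of [w], the remainders of the elements
   of the ideal lie in [Q]. *)
have pdiv h : exists k s r, (lead_coef w ^+ k) *: h = s * w + r /\ (I h -> Q r /\ (size r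
  < size w)%N).
  exists (Pdiv.Ring.rscalp h w), (Pdiv.Ring.rdivp h w), (Pdiv.Ring.rmodp h w).
  rewrite Pdiv.ComRing.rdivp_eq; split=> // Ih.
  have rs : (size (Pdiv.Ring.rmodp h w) < size w)%N by rewrite Pdiv.Ring.ltn_rmodp.
  split=> //; apply: w_small => //.
  rewrite -[Pdiv.Ring.rmodp h w](addKr (Pdiv.Ring.rdivp h w * w)) -Pdiv.ComRing.rdivp_eq addrC.
  by rewrite -mul_polyC; apply: ID; [apply: IM|apply/IN/IM].
have nQw : ~ Q w.
  move=> Qw; have [k [s [r [E /(_ _)[|Qr _]]]]] := pdiv v.
    by exists 1, 0; rewrite mul1r addr0; split=> //; apply: ideal0.
  have : Q ((lead_coef w ^+ k)%:P * v).
    by rewrite mul_polyC E; apply: idealD => //; apply: idealMl.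
  by case/QM => //; rewrite polyC_exp => /(primeX Q_prime).
have w1 : size w = 1%N.
  apply: contrapT => w1.
  have [k [s [r [E /(_ (QI _ Qg))[Qr rw]]]]] := pdiv g.
  have Qs : Q s.
    have : Q (s * w) by rewrite -[s * w](addrK r) -E -mul_polyC; apply: idealB => //;
      apply: idealMl.
    by case/QM.
  have rg : coefs_in r.
    apply: g_small => //; apply: (leq_trans rw); apply: wmin; split=> //; exact: QI.
  have lgk : ~ Q (lead_coef w ^+ k * lead_coef g)%:P.
    by rewrite polyCM => /QM[]//; rewrite polyC_exp => /(primeX Q_prime).
  have [sc|[s' [H1 H2 H3]]] := drop_leading_coefs s.
    apply: lgk; have := coefs_inD (coefs_inM w sc) rg (size g).-1.
    by rewrite mulrC -E coefZ.
  have Qs' : Q s' by rewrite -(subKr s s'); apply: idealB => //; apply: coefs_in_sub.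
  have gs' := gmin _ (conj Qs' H1).
  have s'0 : s' != 0 by apply: contra_notN H1 => /eqP->; rewrite lead_coef0 polyC0;
    apply: ideal0.
  have : Q (lead_coef s' * lead_coef w)%:P; last by rewrite polyCM => /QM[].
  rewrite mul_lead_coef.
  have -> : s' * w = (lead_coef w ^+ k) *: g - r - (s - s') * w.
    by rewrite E mulrBl addrK opprB addrC subrK.
  have gbig : (size g <= (size s' + size w).-2)%N.
    have : (1 < size w)%N.
      by rewrite ltn_neqAle eq_sym; apply/andP; split; [exact/eqP|rewrite lt0n size_poly_eq0].
    by move: gs'; case: (size w) => [|[|m]] // le _;
      rewrite !addnS /= (leq_trans le) // leq_addr.
  rewrite coefB coefB coefZ (nth_default _ gbig) mulr0 sub0r.
  have -> a b : (- a - b)%:P = - (a%:P + b%:P) :> {poly A} by rewrite -polyCD -polyCN opprD.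
  apply: idealN => //; apply: idealD => //.
  by rewrite mulrC; apply: coefs_inM.
have [c wc] : exists c, w = c%:P by move/eqP: w1 => /size_poly1P[c _ ->]; exists c.
have lwc : lead_coef w = c by rewrite wc lead_coefC.
rewrite lwc in wl; case: Iw => [al [q [Qq Ew]]].
have sg : size g != 1%N.
  by apply/negP => /size_poly1P[e _ ge]; apply: gl; rewrite ge lead_coefC -ge.
exists (lead_coef g * c); first by rewrite polyCM => /QM[].
move=> phi phiQ; rewrite rmorphM mulf_eq0 negb_or => /andP[phig phic].
have /closed_rootP[d /rootP gd] : size (map_poly phi g) != 1%N.
  by rewrite size_map_poly_id0.
have dQ h : Q h -> (map_poly phi h).[d] = 0.
  move=> Qh; have := Pdiv.ComRing.rdivp_eq g h.
  set k := Pdiv.Ring.rscalp _ _; set s := Pdiv.Ring.rdivp _ _;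
    set r := Pdiv.Ring.rmodp _ _ => E.
  have rc : coefs_in r.
    apply: g_small; last by rewrite Pdiv.Ring.ltn_rmodp.
    rewrite -[r](addKr (s * g)) -E addrC -mul_polyC; apply: idealB => //; exact: idealMl.
  have /(congr1 (fun p => p.[d])) := congr1 (map_poly phi) E.
  rewrite -mul_polyC rmorphD !rmorphM /= map_polyC (coefs0 phi r) // addr0 !hornerM gd
    mulr0 hornerC /= rmorphXn.
  by move/eqP; rewrite mulf_eq0 expf_eq0 (negPf phig) andbF => /eqP.
exists d => //; apply: contraNneq phic => vd.
have /(congr1 (fun p => (map_poly phi p).[d])) := Ew.
rewrite wc map_polyC hornerC rmorphD rmorphM hornerD hornerM vd mulr0 add0r => ->.
by rewrite dQ.
Qed.
End OneVariable.

(** * Points on the zero set of a prime ideal *)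

Local Notation var := (fun i => mpolyX _ (mnm1 i)).

Lemma mpoly_rmorph_eq (n : nat) (K S : comNzRingType)
    (f g : {rmorphism mpoly n K -> S}) :
    (forall c, f (mpolyC n c) = g (mpolyC n c)) ->
    (forall i, f (var i) = g (var i)) -> f =1 g.
Proof.
move=> fgC fgX; elim/mpolyind => [|c m p _ _ IHp]; first by rewrite !rmorph0.
rewrite !rmorphD IHp -mul_mpolyC !rmorphM fgC mpolyXE_id !rmorph_prod; congr (_ * _ + _).
by apply: eq_bigr => i _; rewrite !rmorphXn fgX.
Qed.

Section ClosedPoints.
Variables (C : numClosedFieldType) (n : nat).
Local Notation B := (mpoly n C).
Implicit Types (S : pred 'I_n) (c : 'I_n -> C).

(** Setting the variables outside [S] to 0; the polynomials in the variables
    of [S] are the image of this map. *)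
Definition keep_vars S (p : B) : B :=
  mmap (@mpolyC n C) (fun i => if S i then var i else 0) p.

HB.instance Definition _ S := GRing.RMorphism.copy (keep_vars S)
  (mmap (@mpolyC n C) (fun i => if S i then var i else 0)).

Lemma keep_varsC S a : keep_vars S (mpolyC n a) = mpolyC n a.
Proof. by rewrite /keep_vars mmapC. Qed.

Lemma keep_varsX S i : keep_vars S (var i) = if S i then var i else 0.
Proof. by rewrite /keep_vars mmapX mmap1U. Qed.

Lemma keep_varsT p : keep_vars predT p = p.
Proof.
apply: (mpoly_rmorph_eq (f := keep_vars predT) (g := idfun)) => [c|i] /=.
  exact: keep_varsC.
by rewrite keep_varsX.
Qed.

Lemma eq_keep_vars S S' : S =1 S' -> keep_vars S =1 keep_vars S'.
Proof.
move=> SS'; apply: (mpoly_rmorph_eq (f := keep_vars S) (g := keep_vars S')) => [a|i] /=;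
  first by rewrite !keep_varsC.
by rewrite !keep_varsX SS'.
Qed.

Lemma keep_vars0 p : keep_vars pred0 p = mpolyC n (meval (fun=> 0) p).
Proof.
apply: (mpoly_rmorph_eq (f := keep_vars pred0) (g := @mpolyC n C \o meval (fun=> 0))) =>
  [c|i] /=.
  by rewrite keep_varsC mevalC.
by rewrite keep_varsX mevalXU /= mpolyC0.
Qed.

Lemma meval_keep_vars S c p : (forall i, ~~ S i -> c i = 0) ->
  meval c (keep_vars S p) = meval c p.
Proof.
move=> cS; apply: (mpoly_rmorph_eq (f := meval c \o keep_vars S) (g := meval c)) => [a|i] /=.
  by rewrite keep_varsC.
rewrite keep_varsX; case: ifPn => // Si; by rewrite meval0 mevalXU cS.
Qed.

(** The variable [k] becomes the indeterminate of a univariate polynomial, so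
    that the extension of points can proceed one coordinate at a time. *)
Definition isolate S k (p : B) : {poly B} :=
  mmap (polyC \o @mpolyC n C)
    (fun i => if i == k then 'X else if S i then (var i)%:P else 0) p.

HB.instance Definition _ S k := GRing.RMorphism.copy (isolate S k)
  (mmap (polyC \o @mpolyC n C)
    (fun i => if i == k then 'X else if S i then (var i)%:P else 0)).

Lemma isolateC S k a : isolate S k (mpolyC n a) = (mpolyC n a)%:P.
Proof. by rewrite /isolate mmapC. Qed.

Lemma isolateX S k i : isolate S k (var i) =
  if i == k then 'X else if S i then (var i)%:P else 0.
Proof. by rewrite /isolate mmapX mmap1U. Qed.

Lemma horner_isolate S k p :
  (map_poly (keep_vars S) (isolate S k p)).[var k] = keep_vars (predU1 k S) p.
Proof.
apply: (mpoly_rmorph_eq (f := horner_eval (var k) \o map_poly (keep_vars S) \o isolate S k)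
  (g := keep_vars (predU1 k S))) => [a|i] /=; rewrite /horner_eval /=.
  by rewrite isolateC map_polyC hornerC /= !keep_varsC.
rewrite isolateX keep_varsX /=; have [->|ik] := eqVneq i k.
  by rewrite map_polyX hornerX.
case: ifPn => Si /=; first by rewrite map_polyC hornerC /= keep_varsX Si.
by rewrite rmorph0 horner0.
Qed.

Lemma meval_isolate S k c d p : (forall i, ~~ S i -> c i = 0) ->
  (map_poly (meval c) (isolate S k p)).[d] =
    meval (fun i => if i == k then d else c i) p.
Proof.
move=> cS; apply: (mpoly_rmorph_eq
  (f := horner_eval d \o map_poly (meval c) \o isolate S k)
  (g := meval (fun i => if i == k then d else c i))) => [a|i] /=; rewrite /horner_eval /=.
  by rewrite isolateC map_polyC hornerC /= !mevalC.
rewrite isolateX mevalXU; have [ik|ik] := eqVneq i k.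
  by rewrite map_polyX hornerX.
case: ifPn => Si /=; first by rewrite map_polyC hornerC /= mevalXU.
by rewrite rmorph0 horner0 cS.
Qed.

Variable P : set B.
Hypothesis P_prime : is_prime_ideal P.

(** The points of the closure of the projection of the zero set of [P] to the
    coordinates in [S], extended by 0. *)
Definition base_point S c := forall p, P (keep_vars S p) -> meval c p = 0.

Lemma base_point0 S c i : base_point S c -> ~~ S i -> c i = 0.
Proof.
move=> cP Si; rewrite -[c i]mevalXU; apply: cP.
by rewrite keep_varsX (negPf Si); apply: ideal0; case: P_prime.
Qed.

(** One application of [extend_one_variable] for each coordinate outside [S];
    the polynomial [u] obtained at one step is what the next step must keep
    from vanishing. *)
Lemma extend_base_point (S : pred 'I_n) (v : B) : ~ P v -> exists2 u, ~ P (keep_vars S u) &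
  forall c, base_point S c -> meval c u != 0 ->
    exists c', [/\ zero_set P c', meval c' v != 0 & forall i, S i -> c' i = c i].
Proof.
move=> Pv.
have [l lS] : exists l : seq 'I_n, forall i, (i \in l) || S i.
  by exists (enum 'I_n) => i; rewrite mem_enum.
elim: l S lS => [|k l IHl] S lS.
  have ST : S =1 predT by exact: lS.
  exists v; first by rewrite (eq_keep_vars ST) keep_varsT.
  move=> c cP cv; exists c; split=> // p Pp; apply: cP.
  by rewrite (eq_keep_vars ST) keep_varsT.
have [kS|kS] := boolP (S k).
  by apply: IHl => i; have := lS i; rewrite inE; have [->|] := eqVneq i k;
    first by rewrite kS !orbT.
have [|u1 Pu1 Hu1] := IHl (predU1 k S).
  by move=> i; have := lS i; rewrite /= !inE -orbA orbCA.
pose Q : set {poly B} := [set F | P (map_poly (keep_vars S) F).[var k]].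
have Q_prime : is_prime_ideal Q.
  have [[P0 PD PM] P1 PP] := P_prime; rewrite /Q; split=> /=.
  - split=> /=; first by rewrite rmorph0 horner0.
      by move=> a b; rewrite rmorphD hornerD; apply: PD.
    by move=> a b; rewrite rmorphM hornerM; apply: PM.
  - by rewrite rmorph1 hornerC.
  - by move=> a b; rewrite rmorphM hornerM; apply: PP.
have Qv : ~ Q (isolate S k u1) by rewrite /Q /= horner_isolate.
have [u Qu Hu] := extend_one_variable C Q_prime Qv.
exists u; first by move: Qu; rewrite /Q /= map_polyC hornerC /=.
move=> c cP cu.
have c0 i : ~~ S i -> c i = 0 by apply: base_point0.
have [|d dQ dv] := Hu (meval c) _ cu.
  by move=> a; rewrite /Q /= map_polyC hornerC /= => /cP.
have [||c' [c'P c'v c'S]] := Hu1 (fun i => if i == k then d else c i) _ _.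
- move=> p Pp; rewrite -(meval_isolate k d p c0); apply: dQ.
  by rewrite /Q /= horner_isolate.
- by rewrite -(meval_isolate k d u1 c0).
exists c'; split=> // i Si; rewrite c'S /= ?inE ?Si ?orbT //.
by case: eqP => // ik; rewrite -ik Si in kS.
Qed.

(** The Nullstellensatz for a prime ideal: over the empty set of coordinates
    the origin is the only base point, and a constant outside [P] is non-zero. *)
Lemma prime_nullstellensatz v : ~ P v -> exists2 x, zero_set P x & meval x v != 0.
Proof.
move=> /(extend_base_point pred0)[u Pu Hu].
have [iP P1 _] := P_prime.
have cst a : P (mpolyC n a) -> a = 0.
  move=> Pa; apply: contrapT => /eqP a0; apply: P1.
  by rewrite -mpolyC1 -(mulVf a0) mpolyCM; apply: idealMl.
have [||x [xP xv _]] := Hu (fun=> 0) _ _; last by exists x.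
  by move=> p; rewrite keep_vars0 => /cst.
by apply: contra_notN Pu => /eqP u0; rewrite keep_vars0 u0 mpolyC0; apply: ideal0.
Qed.

Lemma zero_set_prime_irreducible : irreducible_variety (zero_set P).
Proof.
split; first by exists P.
  by case: P_prime => _ P1 _; have [x xP _] := prime_nullstellensatz P1; exists x.
move=> _ _ [S1 ->] [S2 ->] cov; apply: contrapT => /not_orP[].
have out (S : set B) : ~ zero_set P `<=` zero_set S -> exists2 f, S f & ~ P f.
  move=> no; apply: contrapT => Hf; apply: no => x xP f Sf.
  by apply: contrapT => fx; apply: Hf; exists f => // Pf; apply: fx; apply: xP.
move=> /out[f1 Sf1 Pf1] /out[f2 Sf2 Pf2].
have [_ _ PM] := P_prime.
have [|x xP] := @prime_nullstellensatz (f1 * f2); first by move=> /PM[].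
rewrite rmorphM mulf_eq0 negb_or => /andP[/eqP f1x /eqP f2x].
by have [/(_ _ Sf1)|/(_ _ Sf2)] := cov _ xP.
Qed.

End ClosedPoints.

Section Dimension.
Variables (C : numClosedFieldType) (n : nat).
Local Notation B := (mpoly n C).
Implicit Types (J : set B) (x y : 'I_n -> C).

Lemma singleton_zero_set x :
  [set x] = zero_set [set p | exists i, p = var i - mpolyC n (x i) :> B].
Proof.
apply/seteqP; split=> y.
  by move=> -> p [i ->]; rewrite rmorphB /= mevalXU mevalC subrr.
move=> yx /=; apply/funext => i; apply/eqP; rewrite -subr_eq0; apply/eqP.
by have := yx (var i - mpolyC n (x i)); rewrite rmorphB /= mevalXU mevalC; apply; exists i.
Qed.

Lemma singleton_irreducible x : irreducible_variety [set x].
Proof.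
split; first by eexists; apply: singleton_zero_set.
  by exists x.
by move=> Y1 Y2 _ _ cov; have [] := cov x erefl => ?; [left|right] => y ->.
Qed.

(** A bivariate polynomial is a polynomial in [x_j] whose coefficients are
    polynomials in [x_i]. *)
Definition biv i j (F : {poly {poly C}}) : B :=
  (map_poly (horner_eval (var i) \o map_poly (@mpolyC n C)) F).[var j].

HB.instance Definition _ i j := GRing.RMorphism.copy (biv i j)
  (horner_eval (var j) \o map_poly (horner_eval (var i) \o map_poly (@mpolyC n C))).

Lemma biv_polyC i j a : biv i j a%:P = (map_poly (@mpolyC n C) a).[var i].
Proof. by rewrite /biv map_polyC hornerC. Qed.

Lemma biv_C i j a : biv i j a%:P%:P = mpolyC n a.
Proof. by rewrite biv_polyC map_polyC hornerC. Qed.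

Lemma biv_X i j : biv i j 'X%:P = var i.
Proof. by rewrite biv_polyC map_polyX hornerX. Qed.

Lemma biv_Y i j : biv i j 'X = var j.
Proof. by rewrite /biv map_polyX hornerX. Qed.

Lemma meval_biv i j F x : meval x (biv i j F) = F.[(x j)%:P].[x i].
Proof.
elim/poly_ind: F => [|F a IHF]; first by rewrite !rmorph0 !horner0.
rewrite !hornerE /= rmorphD rmorphM /= biv_Y rmorphD rmorphM /= IHF mevalXU; congr (_ + _).
rewrite biv_polyC; elim/poly_ind: a => [|a b IHa]; first by rewrite rmorph0 !horner0 rmorph0.
by rewrite rmorphD rmorphM /= map_polyX map_polyC !hornerE rmorphD rmorphM /= IHa mevalXU
  mevalC.
Qed.

(** The other variables are set to 0, which makes this the inverse of [biv] on
    the polynomials in [x_i] and [x_j]. *)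
Definition unbiv i j : {rmorphism B -> {poly {poly C}}} :=
  mmap (polyC \o polyC) (fun k => if k == i then 'X%:P else if k == j then 'X else 0).

Lemma unbivC i j a : unbiv i j (mpolyC n a) = a%:P%:P.
Proof. exact: mmapC. Qed.

Lemma unbivX i j k :
  unbiv i j (var k) = if k == i then 'X%:P else if k == j then 'X else 0.
Proof. by rewrite [LHS]mmapX mmap1U. Qed.

Lemma unbivK i j p : biv i j (unbiv i j p) = keep_vars (pred2 i j) p.
Proof.
apply: (mpoly_rmorph_eq (f := biv i j \o unbiv i j) (g := keep_vars (pred2 i j))) => [a|k] /=.
  by rewrite unbivC biv_C keep_varsC.
rewrite unbivX keep_varsX /=; have [->|_] := eqVneq k i; first by rewrite biv_X.
by have [->|_] := eqVneq k j; [rewrite biv_Y|rewrite rmorph0].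
Qed.

Lemma prime_has_zero_outside (P : set B) p : is_prime_ideal P ->
  (forall x, zero_set P x -> meval x p = 0) -> P p.
Proof.
move=> Pp p0; apply: contrapT => /(prime_nullstellensatz Pp)[x xP].
by rewrite p0 // eqxx.
Qed.

Lemma horner2_nonroot (F : {poly {poly C}}) : F != 0 ->
  exists c, map_poly (horner_eval c) F != 0.
Proof.
move=> F0; have /closed_nonrootP[c rc] : lead_coef F != 0 by rewrite lead_coef_eq0.
exists c; apply: contraNneq rc => /polyP/(_ (size F).-1).
by rewrite coef_map coef0 => /eqP.
Qed.

Lemma horner_map_eval (F : {poly {poly C}}) c d :
  (map_poly (horner_eval c) F).[d] = F.[d%:P].[c].
Proof.
by rewrite -[RHS]/(horner_eval c F.[d%:P]) -horner_map /= /horner_eval hornerC.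
Qed.

(** A zero set on which two coordinates are algebraically independent has
    dimension at least 2: a prime [P] over [J] without relation between [x_i]
    and [x_j] gives a component, and a generic hyperplane section [x_i = c]
    of it is still infinite in the direction of [x_j]. *)
Lemma coordinates_dependent J i j : is_ideal J -> i != j ->
  ~ irreducible_chain (zero_set J) 2 -> exists2 F, F != 0 & J (biv i j F).
Proof.
move=> iJ ij noch; apply: contrapT => noF.
have [||P [P_prime JP PS]] := @prime_avoiding _ J [set biv i j F | F in [set F | F != 0]] iJ.
- split; first by exists 1; rewrite /= ?oner_eq0 ?rmorph1.
  move=> _ _ [F /= F0 <-] [G /= G0 <-]; exists (F * G); rewrite /= ?mulf_neq0 //.
  by rewrite rmorphM.
- by move=> _ /[swap] -[F /= F0 <-] JF; apply: noF; exists F.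
have P1 : ~ P 1 by case: P_prime.
have iP : is_ideal P by case: P_prime.
have PF F : P (biv i j F) -> F = 0.
  by move=> PF; apply/eqP; apply: contra_notT (PS _ PF) => F0; exists F.
have [u Pu Hu] := extend_base_point P_prime (pred2 i j) P1.
pose U := unbiv i j u.
have U0 : U != 0.
  by apply: contra_notN Pu => /eqP U0; rewrite -unbivK -/U U0 rmorph0; apply: ideal0.
(* Above almost every point of the line [x_i = c] there is a point of the zero
   set of [P]. *)
have [c cU] := horner2_nonroot U0.
have point d : (map_poly (horner_eval c) U).[d] != 0 ->
    exists x, [/\ zero_set P x, x i = c & x j = d].
  move=> Ud; pose z k := if k == i then c else if k == j then d else 0 : C.
  have zi : z i = c by rewrite /z eqxx.
  have zj : z j = d by rewrite /z eq_sym (negPf ij) eqxx.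
  have z0 k : ~~ pred2 i j k -> z k = 0.
    by rewrite /= /z => /norP[/negPf-> /negPf->].
  have [||x [xP _ xz]] := Hu z.
  - move=> p; rewrite -unbivK => /PF p0.
    by rewrite -(meval_keep_vars _ z0) -unbivK p0 rmorph0 rmorph0.
  - by rewrite -(meval_keep_vars _ z0) -unbivK meval_biv zi zj -horner_map_eval.
  by exists x; rewrite !xz /= ?eqxx ?orbT.
have [|||P' [P'_prime PP' P'S]] := @prime_avoiding _
    [set x | exists2 y, P y & exists z, x = y + z * (var i - mpolyC n c)]
    [set biv i j (map_poly polyC f) | f in [set f : {poly C} | f != 0]].
- exact: is_ideal_add_principal.
- split; first by exists 1; rewrite /= ?oner_eq0 // rmorph1 rmorph1.
  move=> _ _ [F /= F0 <-] [G /= G0 <-]; exists (F * G); rewrite /= ?mulf_neq0 //.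
  by rewrite !rmorphM.
- move=> _ [y Py [z ->]] [f /= f0 E].
  have /closed_nonrootP[d] : f * map_poly (horner_eval c) U != 0 by rewrite mulf_neq0.
  rewrite rootE hornerM mulf_eq0 negb_or => /andP[fd Ud].
  have [x [xP xi xj]] := point d Ud.
  have /(congr1 (meval x)) := E.
  rewrite meval_biv rmorphD rmorphM rmorphB /= mevalXU mevalC xi subrr mulr0 addr0 (xP y)
    // xj.
  by rewrite -horner_map_eval -map_poly_comp map_poly_id ?(negPf fd) // => [/eqP|a _ /=];
    rewrite ?(negPf fd) // /horner_eval hornerC.
have [pt ptP' _] : exists2 x, zero_set P' x & meval x 1 != 0.
  by apply: prime_nullstellensatz; case: P'_prime.
have sub : zero_set P' `<=` zero_set P.
  move=> x xP' p Pp; apply: xP'; apply: PP'; exists p => //; exists 0.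
  by rewrite mul0r addr0.
apply: noch; exists (fun k => if k is k'.+1 then if k' is 0%N then zero_set P' else
  zero_set P else [set pt]).
split.
  have PJ : zero_set P `<=` zero_set J by move=> x xP p /JP; apply: xP.
  move=> [|[|k]] _; split.
  - exact: singleton_irreducible.
  - by move=> _ ->; apply/PJ/sub.
  - exact: zero_set_prime_irreducible.
  - by move=> x /sub/PJ.
  - exact: zero_set_prime_irreducible.
  - exact: PJ.
have vart k a : biv k j ('X%:P - a%:P%:P) = var k - mpolyC n a.
  by rewrite rmorphB /= biv_X biv_C.
move=> [|[|//]] _; split.
- by move=> _ ->.
- move=> P'pt; apply: (P'S (var j - mpolyC n (pt j))).
    apply: prime_has_zero_outside => // x /P'pt ->.
    by rewrite rmorphB /= mevalXU mevalC subrr.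
  exists ('X - (pt j)%:P); first by rewrite /= polyXsubC_eq0.
  by rewrite rmorphB /= map_polyX map_polyC rmorphB /= biv_Y biv_C.
- exact: sub.
- move=> PP; apply: (PS (var i - mpolyC n c)).
    apply: prime_has_zero_outside => // x /PP xP'; apply: xP'; apply: PP'.
    by exists 0; [apply: ideal0|exists 1; rewrite mul1r add0r].
  exists ('X%:P - c%:P%:P); last exact: vart.
  by rewrite /= -polyCB polyC_eq0 polyXsubC_eq0.
Qed.

(** As [x_i - y_i] is not a zero divisor modulo [J], some prime over [J] lies in
    the ideal of the point [y] and misses [x_i - y_i]; its zero set is an
    irreducible set through [y] with a second point. *)
Lemma not_isolated_point J y i : is_ideal J -> zero_set J y ->
    (forall f, J ((var i - mpolyC n (y i)) * f) -> J f) ->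
  ~ irreducible_component (zero_set J) [set y].
Proof.
move=> iJ yJ reg [_ _ ymax]; set t := var i - mpolyC n (y i) in reg.
have [||P [P_prime JP PS]] := @prime_avoiding _ J
    [set g | exists k f, meval y f != 0 /\ g = t ^+ k * f] iJ.
- split; first by exists 0%N, 1; rewrite rmorph1 oner_eq0 mulr1.
  move=> _ _ [k [f [f0 ->]]] [l [g [g0 ->]]]; exists (k + l)%N, (f * g).
  by rewrite rmorphM mulf_neq0 // exprD mulrACA.
- move=> _ /[swap] -[k [f [f0 ->]]].
  elim: k => [|k IHk]; last by rewrite exprS -mulrA => /reg.
  by rewrite mul1r => /yJ/eqP; apply/negP.
have yP : zero_set P y.
  move=> p Pp; apply: contrapT => /eqP p0; apply: (PS _ Pp).
  by exists 0%N, p; rewrite mul1r.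
have Pt : ~ P t.
  by move=> Pt; apply: (PS _ Pt); exists 1%N, 1; rewrite rmorph1 oner_eq0 expr1 mulr1.
have [x xP xt] := prime_nullstellensatz P_prime Pt.
have Py : zero_set P = [set y].
  apply: ymax; first exact: zero_set_prime_irreducible.
    by move=> z zP p /JP; apply: zP.
  by move=> _ ->.
move: xt; have -> : x = y by rewrite Py in xP.
by rewrite rmorphB /= mevalXU mevalC subrr eqxx.
Qed.

End Dimension.

(** * Orthogonality in a Hilbert space *)

Section Hilbert.
Variables (R : realType) (H : completeNormedModType R[i]).
Variable dot : {dot H for Num.conj}.
Hypothesis Hdot : norm_from_dot dot.
Local Notation C := R[i].
Implicit Types (x y z u v w : H) (K L : set H) (a b c : C).

Lemma dotDl z x y : dot (x + y) z = dot x z + dot y z. Proof. exact: linearDl. Qed.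
Lemma dotDr z x y : dot z (x + y) = dot z x + dot z y. Proof. exact: linearDr. Qed.
Lemma dotBl z x y : dot (x - y) z = dot x z - dot y z. Proof. exact: linearBl. Qed.
Lemma dotBr z x y : dot z (x - y) = dot z x - dot z y. Proof. exact: linearBr. Qed.
Lemma dotZl a x y : dot (a *: x) y = a * dot x y. Proof. exact: linearZl_LR. Qed.
Lemma dotZr a x y : dot x (a *: y) = a^* * dot x y. Proof. exact: linearZr_LR. Qed.
Lemma dot0l x : dot 0 x = 0. Proof. exact: linear0l. Qed.
Lemma dot0r x : dot x 0 = 0. Proof. exact: linear0r. Qed.
Lemma dotC x y : dot x y = (dot y x)^*.
Proof. by rewrite hermC /= expr0 mul1r. Qed.

Lemma dot_sumr x (I : Type) (r : seq I) (Q : pred I) (F : I -> H) :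
  dot x (\sum_(i <- r | Q i) F i) = \sum_(i <- r | Q i) dot x (F i).
Proof. exact: linear_sumr. Qed.

Lemma dot_suml x (I : Type) (r : seq I) (Q : pred I) (F : I -> H) :
  dot (\sum_(i <- r | Q i) F i) x = \sum_(i <- r | Q i) dot (F i) x.
Proof. exact: linear_sumlz. Qed.

Lemma dot_self_eq0 x : dot x x = 0 -> x = 0.
Proof. by move/eqP; rewrite dnorm_eq0 => /eqP. Qed.

Lemma dot_sym0 x y : dot x y = 0 -> dot y x = 0.
Proof. by move=> xy; rewrite dotC xy conjC0. Qed.

(** From the positivity of [dot v v] for [v = dot y y *: x - dot x y *: y]. *)
Lemma cauchy_schwarz x y : `|dot x y| <= `|x| * `|y|.
Proof.
rewrite -(@ler_pXn2r _ 2) ?nnegrE ?mulr_ge0 // exprMn !Hdot.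
have [->|y0] := eqVneq y 0; first by rewrite !dot0r mulr0 normr0 expr0n.
have yy : 0 < dot y y by rewrite dnorm_gt0.
have yyR : (dot y y)^* = dot y y by apply: conj_Creal; apply: gtr0_real.
have := dnorm_ge0 dot (dot y y *: x - dot x y *: y).
rewrite !(dotBl, dotBr, dotZl, dotZr) yyR (dotC y x).
set xy := dot x y; set s := dot x x; set t := dot y y in yy yyR *.
set e := (X in 0 <= X); have -> : e = t * (s * t - `|xy| ^+ 2).
  by rewrite /e normCK; ring.
by rewrite pmulr_rge0 // subr_ge0.
Qed.

(** ** Approximation by real tolerances *)

Lemma pos_complexP (e : C) : 0 < e -> exists2 r : R, 0 < r & e = r%:C%C.
Proof.
move=> e0; exists (complex.Re e); last by rewrite RRe_real // gtr0_real.
by rewrite -ltcR RRe_real // gtr0_real.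
Qed.

Lemma norm_complexP x : exists2 r : R, 0 <= r & `|x| = r%:C%C.
Proof.
exists (complex.Re `|x|); last by rewrite RRe_real.
by rewrite -lecR RRe_real // normr_ge0.
Qed.

Lemma closed_approx K x : closed K ->
  (forall e : R, 0 < e -> exists2 y, K y & `|x - y| < e%:C%C) -> K x.
Proof.
move=> cK Kx; apply: cK => B /nbhs_ballP[e /= /pos_complexP[r r0 ->]] rB.
have [y Ky xy] := Kx r r0; exists y; split=> //; apply: rB.
by rewrite -ball_normE.
Qed.

Lemma approx_closed K :
  (forall x, (forall e : R, 0 < e -> exists2 y, K y & `|x - y| < e%:C%C) -> K x) ->
  closed K.
Proof.
move=> HK x clx; apply: HK => e e0.
have [|y [Ky xy]] := clx (ball x (e%:C)%C); last by exists y; rewrite // -ball_normE in xy *.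
by apply: nbhsx_ballx; rewrite ltcR.
Qed.

Lemma null_norm x : (forall e : R, 0 < e -> `|x| < e%:C%C) -> x = 0.
Proof.
move=> Hx; apply/eqP; rewrite -normr_eq0; apply: contrapT => /negP x0.
have [|r r0 E] := @pos_complexP `|x|; first by rewrite lt_neqAle eq_sym x0 normr_ge0.
by have := Hx r r0; rewrite E ltxx.
Qed.

Lemma null_complex a : (forall e : R, 0 < e -> `|a| < e%:C%C) -> a = 0.
Proof.
move=> Ha; apply/eqP; rewrite -normr_eq0; apply: contrapT => /negP a0.
have [|r r0 E] := @pos_complexP `|a|; first by rewrite lt_neqAle eq_sym a0 normr_ge0.
by have := Ha r r0; rewrite E ltxx.
Qed.

(** The form in which completeness enters, for projections as well as for
    closed ranges: [G e] is the set of approximate solutions with error [e]. *)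
Lemma nested_limit K (G : R -> set H) : closed K ->
    (forall e, 0 < e -> G e !=set0) ->
    (forall e e', 0 < e -> e <= e' -> G e `<=` G e') ->
    (forall e, G e `<=` K) ->
    (forall d : R, 0 < d -> exists2 e, 0 < e &
       forall y z, G e y -> G e z -> `|y - z| < d%:C%C) ->
  exists2 x, K x & forall e d : R, 0 < e -> 0 < d ->
    exists2 y, G e y & `|x - y| < d%:C%C.
Proof.
move=> cK G0 Gmono GK Gdiam.
pose F := filter_from [set e : R | 0 < e] G.
have FF : ProperFilter F.
  apply: filter_from_proper => //; apply: filter_from_filter; first by exists 1;
    rewrite /= ltr01.
  move=> e e' /= e0 e'0; exists (Num.min e e'); first by rewrite /= lt_min e0.
  by move=> y Gy; split; apply: Gmono Gy; rewrite ?lt_min ?e0 // ge_min lexx ?orbT.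
have cF : cauchy F.
  apply: cauchy_exP => eps /pos_complexP[d d0 ->]; have [e e0 Ge] := Gdiam d d0.
  have [y Gy] := G0 e e0; exists y; exists e => // z Gz.
  by rewrite -ball_normE; apply: Ge.
have /cvg_ex[x Fx] := @cauchy_cvg H F FF cF.
have near e d : 0 < e -> 0 < d -> exists2 y, G e y & `|x - y| < d%:C%C.
  move=> e0 d0; have : F (ball x (d%:C)%C) by apply: Fx; apply: nbhsx_ballx; rewrite ltcR.
  move=> [e1 /= e10 G1]; have [|y Gy] := G0 (Num.min e e1); first by rewrite lt_min e0.
  exists y; first by apply: Gmono Gy; rewrite ?lt_min ?e0 // ge_min lexx.
  have : ball x (d%:C)%C y.
    by apply: G1; apply: Gmono Gy; rewrite ?lt_min ?e0 // ge_min lexx orbT.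
  by rewrite -ball_normE.
exists x => //; apply: closed_approx => // e e0.
by have [y Gy xy] := near 1 e ltr01 e0; exists y => //; apply: GK Gy.
Qed.

(** ** Subspaces and projections *)

Lemma subspace0 K : closed_subspace K -> K 0.
Proof. by case=> _ [K0 _]; have := K0; rewrite inE. Qed.

Lemma subspaceP K a x y : closed_subspace K -> K x -> K y -> K (a *: x + y).
Proof. by case=> _ [_ +] Kx Ky => /(_ a x y); rewrite !inE; apply. Qed.

Lemma subspaceZ K a x : closed_subspace K -> K x -> K (a *: x).
Proof. by move=> cK Kx; rewrite -[_ *: _]addr0; apply: subspaceP => //; apply: subspace0. Qed.

Lemma subspaceD K x y : closed_subspace K -> K x -> K y -> K (x + y).
Proof. by move=> cK Kx Ky; rewrite -[x]scale1r; apply: subspaceP. Qed.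

Lemma subspaceN K x : closed_subspace K -> K x -> K (- x).
Proof. by move=> cK Kx; rewrite -scaleN1r; apply: subspaceZ. Qed.

Lemma subspaceB K x y : closed_subspace K -> K x -> K y -> K (x - y).
Proof. by move=> cK Kx Ky; apply: subspaceD => //; apply: subspaceN. Qed.

Lemma subspace_sum K (I : Type) (r : seq I) (Q : pred I) (F : I -> H) :
  closed_subspace K -> (forall i, Q i -> K (F i)) -> K (\sum_(i <- r | Q i) F i).
Proof. by move=> cK KF; apply: big_ind => //; [exact: subspace0|move=> *;
  apply: subspaceD]. Qed.

Lemma closed_subspace_intro K : closed K -> K 0 ->
  (forall a x y, K x -> K y -> K (a *: x + y)) -> closed_subspace K.
Proof.
move=> cK K0 KP; split=> //; split; first by rewrite inE.
by move=> a x y; rewrite !inE; apply: KP.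
Qed.

Lemma whole_subspace : closed_subspace [set: H].
Proof. by apply: closed_subspace_intro => //; exact: closedT. Qed.

Lemma closed_subspaceI K L :
  closed_subspace K -> closed_subspace L -> closed_subspace (K `&` L).
Proof.
move=> cK cL; apply: closed_subspace_intro.
- by apply: closedI; [case: cK|case: cL].
- by split; apply: subspace0.
- by move=> a x y [Kx Lx] [Ky Ly]; split; apply: subspaceP.
Qed.

Lemma closed_subspace_bigcap (I : Type) (D : set I) (F : I -> set H) :
  (forall i, D i -> closed_subspace (F i)) -> closed_subspace (\bigcap_(i in D) F i).
Proof.
move=> cF; apply: closed_subspace_intro.
- by apply: closed_bigI => i /cF[].
- by move=> i Di; apply: subspace0; apply: cF.
- by move=> a x y Fx Fy i Di; apply: subspaceP; [apply: cF|apply: Fx|apply: Fy].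
Qed.

Lemma orthocomplement_subspace K : closed_subspace (orthocomplement dot K).
Proof.
apply: closed_subspace_intro; last 1 first.
- by move=> a x y Kx Ky z Kz; rewrite dotDl dotZl Kx // Ky // mulr0 addr0.
- apply: approx_closed => x Hx z Kz; apply: null_complex => e e0.
  have [r r0 Ez] := norm_complexP z.
  have [|y Ky xy] := Hx (e / (r + 1)); first by rewrite divr_gt0 // ltr_wpDl.
  rewrite -[x](subrK y) dotDl (Ky z Kz) addr0.
  apply: le_lt_trans (cauchy_schwarz _ _) _.
  have r1 : 0 < r + 1 by rewrite ltr_wpDl.
  apply: (@le_lt_trans _ _ ((e / (r + 1) * r)%:C)%C); last first.
    rewrite ltcR mulrAC ltr_pdivrMr // mulrDr mulr1 ltrDl //.
  by rewrite rmorphM /= Ez; apply: ler_wpM2r; [rewrite lecR|exact: ltW].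
- by move=> z _; rewrite dot0l.
Qed.

Lemma dot_selfE z : dot z z = (complex.Re (dot z z))%:C%C.
Proof. by rewrite RRe_real // ger0_real // dnorm_ge0. Qed.

Lemma parallelogram u v :
  dot (u - v) (u - v) = 2 * dot u u + 2 * dot v v - dot (u + v) (u + v).
Proof. by rewrite !(dotBl, dotBr, dotDl, dotDr); ring. Qed.

Lemma dot_remove_component u z : z != 0 ->
  dot (u - (dot u z / dot z z) *: z) (u - (dot u z / dot z z) *: z) =
  dot u u - `|dot u z| ^+ 2 / dot z z.
Proof.
move=> z0; have zz : dot z z != 0 by rewrite dnorm_eq0.
have zzR : (dot z z)^* = dot z z by apply: conj_Creal; rewrite ger0_real // dnorm_ge0.
rewrite !(dotBl, dotBr, dotZl, dotZr) (dotC z u) fmorph_div /= zzR normCK.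
by field.
Qed.

(** By the parallelogram identity, points of [K] that nearly minimize the
    distance to [x] are close to each other; near-minimality of [k] bounds the
    inner product of [x - k] with every vector of [K]. *)
Lemma orthogonal_projection K x : closed_subspace K ->
  exists2 y, K y & orthocomplement dot K (x - y).
Proof.
move=> sK; pose N z := complex.Re (dot z z).
have N0 z : 0 <= N z by rewrite -lecR -dot_selfE dnorm_ge0.
pose D := [set N (x - k) | k in K]; pose d := inf D.
have D0 : D !=set0 by exists (N (x - 0)), 0 => //; apply: subspace0.
have lbD : has_lbound D by exists 0 => _ [k _ <-].
have dN k : K k -> d <= N (x - k) by move=> Kk; apply: ge_inf => //; exists k.
pose G e := [set k | K k /\ N (x - k) < d + e].
have [||||r r0|y Ky yG] := @nested_limit K G.
- by case: sK.
- move=> e e0; have [_ [k Kk <-] kd] := inf_adherent e0 (conj D0 lbD).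
  by exists k.
- by move=> e e' _ ee' k [Kk kd]; split=> //; apply: lt_le_trans kd _; rewrite lerD2l.
- by move=> e k [].
- exists (r ^+ 2 / 4); first by rewrite divr_gt0 // exprn_gt0.
  move=> k l [Kk kd] [Kl ld].
  rewrite -(@ltr_pXn2r _ 2) ?nnegrE // ?lecR ?ltW // Hdot.
  have -> : k - l = (x - l) - (x - k) by rewrite opprB [RHS]addrC addrA subrK.
  rewrite parallelogram.
  have -> : (x - l) + (x - k) = 2 *: (x - (2^-1 *: (k + l))).
    by rewrite scalerBr scalerA mulfV ?pnatr_eq0 // scale1r scaler_nat mulr2n opprD
      addrACA (addrC (- l)).
  rewrite dotZl dotZr conjC_nat (dot_selfE (x - l)) (dot_selfE (x - k)) (dot_selfE (x - _
    *: _)).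
  have Km : K (2^-1 *: (k + l)) by apply: subspaceZ => //; apply: subspaceD.
  have := dN _ Km; move: (_ *: (k + l)) => m dm; rewrite -/(N _) -/(N _) -/(N _).
  rewrite -!(rmorph_nat (real_complex R)) -!rmorphM -rmorphD -rmorphB -rmorphXn /= ltcR; lra.
exists y => // z Kz.
have [->|z0] := eqVneq z 0; first by rewrite dot0r.
have zz : 0 < dot z z by rewrite dnorm_gt0.
have Gsmall e k : G e k -> `|dot (x - k) z| ^+ 2 <= (e * N z)%:C%C.
  move=> [Kk kd]; have := dot_remove_component (x - k) z0.
  set t := _ / _ => E; have : (d%:C)%C <= dot (x - k - t *: z) (x - k - t *: z).
    rewrite dot_selfE lecR -addrA -opprD; apply: dN.
    by apply: subspaceD => //; apply: subspaceZ.
  rewrite E lerBrDr -lerBrDl ler_pdivrMr // => /le_trans; apply.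
  rewrite rmorphM /= -dot_selfE ler_pM2r // lerBlDl dot_selfE -rmorphD lecR.
  exact: ltW.
apply: null_complex => e e0; have [nz nz0 Ez] := norm_complexP z.
have e2 : 0 < e / 2 by rewrite divr_gt0.
have Nz1 : 0 < N z + 1 by rewrite ltr_wpDl.
have nz1 : 0 < nz + 1 by rewrite ltr_wpDl.
have [||k Gk ky] := yG ((e / 2) ^+ 2 / (N z + 1)) (e / 2 / (nz + 1)).
- by rewrite divr_gt0 // exprn_gt0.
- by rewrite divr_gt0.
have -> : x - y = (x - k) - (y - k) by rewrite opprB addrA subrK.
rewrite dotBl; apply: le_lt_trans (ler_normB _ _) _.
have -> : (e%:C)%C = (e / 2)%:C%C + (e / 2)%:C%C by rewrite -rmorphD -splitr.
apply: ltrD.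
  rewrite -(@ltr_pXn2r _ 2) ?nnegrE // ?lecR ?ltW //.
  apply: le_lt_trans (Gsmall _ _ Gk) _; rewrite -rmorphXn ltcR.
  by rewrite mulrAC ltr_pdivrMr // mulrDr mulr1 ltrDl exprn_gt0.
apply: le_lt_trans (cauchy_schwarz _ _) _; rewrite Ez.
apply: (@le_lt_trans _ _ ((e / 2 / (nz + 1) * nz)%:C)%C).
  by rewrite rmorphM /=; apply: ler_wpM2r; [rewrite lecR|exact: ltW].
by rewrite ltcR mulrAC ltr_pdivrMr // mulrDr mulr1 ltrDl.
Qed.

Lemma orthocomplementK K x : closed_subspace K ->
  (forall w, orthocomplement dot K w -> dot x w = 0) -> K x.
Proof.
move=> sK xK; have [y Ky xy] := orthogonal_projection x sK.
suff : x - y = 0 by move/subr0_eq=> ->.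
by apply: dot_self_eq0; rewrite dotBl xK // (dot_sym0 (xy y Ky)) subrr.
Qed.

Lemma orthocomplement_within K L x : closed_subspace L -> L `<=` K ->
  closed_subspace K -> K x ->
  (forall w, K w -> orthocomplement dot L w -> w = 0) -> L x.
Proof.
move=> sL LK sK Kx HL; have [y Ly xy] := orthogonal_projection x sL.
suff : x - y = 0 by move/subr0_eq=> ->.
by apply: HL => //; apply: subspaceB => //; apply: LK.
Qed.

(** ** Images of closed subspaces *)

(** An operator that is bounded below on [K] reflects Cauchy families. *)
Lemma closed_image (T : {linear H -> H}) (b c : R) K : closed_subspace K -> 0 < c ->
    (forall x, `|T x| <= b%:C%C * `|x|) ->
    (forall x, K x -> `|x| <= c%:C%C * `|T x|) ->
  closed_subspace (T @` K).
Proof.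
move=> sK c0 Tb Tc; apply: closed_subspace_intro; last 1 first.
- move=> a _ _ [x Kx <-] [y Ky <-]; exists (a *: x + y); first exact: subspaceP.
  by rewrite linearP.
- apply: approx_closed => y Hy.
  pose G e := [set k | K k /\ `|y - T k| < e%:C%C].
  have [||||r r0|x Kx xG] := @nested_limit K G.
  + by case: sK.
  + by move=> e /Hy[_ [k Kk <-] ky]; exists k.
  + by move=> e e' _ ee' k [Kk kd]; split=> //; apply: lt_le_trans kd _; rewrite lecR.
  + by move=> e k [].
  + exists (r / c / 2); first by rewrite !divr_gt0.
    move=> k l [Kk ky] [Kl ly]; apply: le_lt_trans (Tc _ _) _; first exact: subspaceB.
    rewrite linearB /= mulrC -ltr_pdivlMr ?ltcR // -fmorph_div /=.
    have -> : T k - T l = (y - T l) - (y - T k) by rewrite opprB [RHS]addrC addrA subrK.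
    apply: le_lt_trans (ler_normB _ _) _.
    by rewrite (splitr (r / c)) rmorphD /=; apply: ltrD.
  exists x => //; apply/eqP; rewrite -subr_eq0; apply/eqP/null_norm => e e0.
  have b0 : 0 < `|b| + 1 by rewrite ltr_wpDl.
  have [||k [Kk ky] kx] := xG (e / 2) (e / 2 / (`|b| + 1)); rewrite ?divr_gt0 //.
  have -> : T x - y = T (x - k) - (y - T k) by rewrite linearB /= opprB addrA subrK.
  apply: le_lt_trans (ler_normB _ _) _; rewrite (splitr e) rmorphD /=; apply: ltrD => //.
  apply: le_lt_trans (Tb _) _.
  apply: (@le_lt_trans _ _ ((`|b| + 1)%:C%C * `|x - k|)).
    by apply: ler_wpM2r => //; rewrite lecR (le_trans (ler_norm b)) // lerDl.
  by rewrite mulrC -ltr_pdivlMr ?ltcR // -fmorph_div.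
- by exists 0; [apply: subspace0|rewrite linear0].
Qed.
End Hilbert.

(** * Adjoints *)

Section Adjoints.
Variables (R : realType) (H : completeNormedModType R[i]).
Variable dot : {dot H for Num.conj}.
Hypothesis Hdot : norm_from_dot dot.
Local Notation C := R[i].
Implicit Types (x y z u v w : H) (K L : set H) (S T : H -> H).

Definition adjoint S T := forall x y, dot (S x) y = dot x (T y).
Definition adjointable S := exists T, adjoint S T.

Lemma adjointable_id : adjointable idfun.
Proof. by exists idfun. Qed.

Lemma adjointable_comp S T : adjointable S -> adjointable T -> adjointable (S \o T).
Proof. by move=> [S' SS'] [T' TT']; exists (T' \o S') => x y; rewrite SS' TT'. Qed.

Lemma adjointable_iter S k : adjointable S -> adjointable (iter k S).
Proof.
move=> aS; elim: k => [|k IHk]; first exact: adjointable_id.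
exact: (adjointable_comp aS IHk).
Qed.

Lemma adjointable_lincomb (a : C) S T : adjointable S -> adjointable T ->
  adjointable (fun x => a *: S x + T x).
Proof.
move=> [S' SS'] [T' TT']; exists (fun y => a^* *: S' y + T' y) => x y.
by rewrite dotDl dotDr dotZl dotZr conjCK SS' TT'.
Qed.

(** Polarization. *)
Lemma isometry_dot (T : {linear H -> H}) K : closed_subspace K -> isometry_on T K ->
  forall x y, K x -> K y -> dot (T x) (T y) = dot x y.
Proof.
move=> sK isoT; have Tn x : K x -> dot (T x) (T x) = dot x x.
  by move=> Kx; rewrite -!Hdot isoT.
have Tsum x y : K x -> K y -> dot (T x) (T y) + dot (T y) (T x) = dot x y + dot y x.
  move=> Kx Ky; have := Tn _ (subspaceD sK Kx Ky).
  rewrite linearD /= !(dotDl, dotDr) (Tn x Kx) (Tn y Ky) => E.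
  apply: (addrI (dot x x)); apply: (addIr (dot y y)).
  by move: E; rewrite !addrA => <-; ring.
move=> x y Kx Ky; have := Tsum ('i *: x) y (subspaceZ _ sK Kx) Ky.
have := Tsum x y Kx Ky; rewrite linearZ /= !dotZl !dotZr conjCi => E1 E2.
have i0 : 'i != 0 :> C by exact: neq0Ci.
have E3 : dot (T x) (T y) - dot (T y) (T x) = dot x y - dot y x.
  by apply: (mulfI i0); rewrite !mulrBr -!mulNr.
have two : 2 != 0 :> C by rewrite pnatr_eq0.
apply: (mulfI two).
have -> : 2 * dot (T x) (T y) = (dot (T x) (T y) + dot (T y) (T x)) +
  (dot (T x) (T y) - dot (T y) (T x)) by ring.
by rewrite E1 E3; ring.
Qed.

Lemma isometry_injective (T : {linear H -> H}) K x :
  isometry_on T K -> K x -> T x = 0 -> x = 0.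
Proof. by move=> isoT Kx Tx; apply/eqP; rewrite -normr_eq0 -isoT // Tx normr0. Qed.

Lemma closed_image_isometry (T : {linear H -> H}) K :
  closed_subspace K -> isometry_on T setT -> closed_subspace (T @` K).
Proof.
move=> sK isoT; apply: (@closed_image R H T 1 1) => // x *.
all: by rewrite mul1r isoT.
Qed.

(** The adjoint of an isometry [T] sends [y] to the preimage of the projection
    of [y] to the range of [T]. *)
Lemma adjointable_isometry (T : {linear H -> H}) : isometry_on T setT -> adjointable T.
Proof.
move=> isoT; have sT := closed_image_isometry (whole_subspace H) isoT.
have /choice[S HS] y : exists u, forall x, dot (T x) (y - T u) = 0.
  have [_ [u _ <-] Hu] := orthogonal_projection Hdot y sT.
  by exists u => x; apply: dot_sym0; apply: Hu; exists x.
exists S => x y; rewrite -[y in LHS](subrK (T (S y))) dotDr HS add0r.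
exact: isometry_dot (whole_subspace H) isoT _ _ I I.
Qed.

(** The kernel is the orthogonal complement of the range of the adjoint. *)
Lemma kernel_subspace (T : H -> H) : adjointable T ->
  closed_subspace [set x | T x = 0].
Proof.
move=> [S TS]; have -> : [set x | T x = 0] = orthocomplement dot (range S).
  apply/seteqP; split=> x /=; first by move=> Tx _ [y _ <-]; rewrite -TS Tx dot0l.
  by move=> Hx; apply: (dot_self_eq0 (dot := dot)); rewrite TS; apply: Hx; exists (T x).
exact: orthocomplement_subspace.
Qed.

End Adjoints.

(** * Polynomials in commuting operators *)

Section PolyApply.
Variables (R : realType) (H : completeNormedModType R[i]) (n : nat).
Variable V : 'I_n -> {linear H -> H}.
Local Notation C := R[i].
Local Notation var := (fun i => mpolyX C (mnm1 i)).
Implicit Types (x y : H) (m : multinom n) (p q : mpoly n C) (r : seq 'I_n).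

(** Over an arbitrary sequence of indices, for the sake of induction. *)
Definition monomial_apply r m x : H :=
  (\big[comp/idfun]_(i <- r) iter (fun_of_multinom m i) (V i)) x.

Lemma monomial_apply_cons i r m x :
  monomial_apply (i :: r) m x = iter (fun_of_multinom m i) (V i) (monomial_apply r m x).
Proof. by rewrite /monomial_apply big_cons. Qed.

Lemma monomial_apply_linear r m a x y :
  monomial_apply r m (a *: x + y) = a *: monomial_apply r m x + monomial_apply r m y.
Proof.
elim: r => [|i r IHr]; first by rewrite /monomial_apply !big_nil.
rewrite !monomial_apply_cons IHr; elim: (fun_of_multinom m i) => //= k ->.
by rewrite linearP.
Qed.

Lemma poly_applyE k p x : (msize p <= k)%N ->
  poly_apply V p x =
    \sum_(m : bmultinom n k) mcoeff m p *: monomial_apply (index_enum 'I_n) m x.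
Proof.
move=> pk; rewrite /poly_apply (ssrcomplements.big_mksub (bmultinom n k)) ?msupp_uniq //=;
  first last.
  by move=> m /msize_mdeg_lt/leq_trans; apply.
rewrite big_rmcond //= => m /memN_msupp_eq0 ->.
by rewrite scale0r.
Qed.

Lemma poly_apply_is_linear p : linear (poly_apply V p).
Proof.
move=> a x y; rewrite /poly_apply scaler_sumr -big_split; apply: eq_bigr => m _ /=.
by rewrite -/(monomial_apply _ _ _) monomial_apply_linear scalerDr !scalerA mulrC.
Qed.

HB.instance Definition _ p :=
  GRing.isLinear.Build C H H *:%R (poly_apply V p) (poly_apply_is_linear p).

Lemma poly_applyD p q x : poly_apply V (p + q) x = poly_apply V p x + poly_apply V q x.
Proof.
pose k := maxn (msize (p + q)) (maxn (msize p) (msize q)).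
rewrite !(@poly_applyE k) ?leq_max ?leqnn ?orbT //.
by rewrite -big_split; apply: eq_bigr => m _; rewrite mcoeffD scalerDl.
Qed.

Lemma poly_applyZ a p x : poly_apply V (a *: p) x = a *: poly_apply V p x.
Proof.
pose k := maxn (msize (a *: p)) (msize p).
rewrite !(@poly_applyE k) ?leq_max ?leqnn ?orbT // scaler_sumr.
by apply: eq_bigr => m _; rewrite mcoeffZ scalerA.
Qed.

Lemma poly_apply0 x : poly_apply V 0 x = 0.
Proof. by rewrite -(scale0r 0) poly_applyZ scale0r. Qed.

Lemma poly_apply_mon m x : poly_apply V (mpolyX C m) x = monomial_apply (index_enum 'I_n) m x.
Proof. by rewrite /poly_apply msuppX big_seq1 mcoeffX eqxx scale1r. Qed.

Lemma poly_apply_const a x : poly_apply V (mpolyC n a) x = a *: x.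
Proof.
rewrite -[mpolyC n a]mulr1 mul_mpolyC poly_applyZ -mpolyX0 poly_apply_mon; congr (_ *: _).
elim: (index_enum 'I_n) => [|i r IHr]; first by rewrite /monomial_apply big_nil.
by rewrite monomial_apply_cons IHr mnm0E.
Qed.

Lemma poly_apply_var i x : poly_apply V (var i) x = V i x.
Proof.
rewrite poly_apply_mon; have : i \in index_enum 'I_n by rewrite mem_index_enum.
have off r : i \notin r -> monomial_apply r (mnm1 i) x = x.
  elim: r => [|j r IHr]; first by rewrite /monomial_apply big_nil.
  rewrite inE negb_or monomial_apply_cons => /andP[ij /IHr->].
  by rewrite mnm1E (negPf ij).
elim: (index_enum 'I_n) (index_enum_uniq 'I_n) => // j r IHr /= /andP[jr ur].
rewrite inE monomial_apply_cons mnm1E => /predU1P[E|ir]; first by rewrite -{}E in jr *;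
  rewrite eqxx off.
have /negPf-> : i != j by apply: contraNneq jr => <-.
exact: IHr.
Qed.

Hypothesis V_comm : forall i j x, V i (V j x) = V j (V i x).

Lemma monomial_apply_comm r m i x :
  monomial_apply r m (V i x) = V i (monomial_apply r m x).
Proof.
elim: r => [|j r IHr]; first by rewrite /monomial_apply !big_nil.
rewrite !monomial_apply_cons IHr; elim: (fun_of_multinom m j) => //= k ->.
by rewrite V_comm.
Qed.

Lemma monomial_applyD r m1 m2 x :
  monomial_apply r (mnm_add m1 m2) x = monomial_apply r m1 (monomial_apply r m2 x).
Proof.
elim: r => [|j r IHr]; first by rewrite /monomial_apply !big_nil.
rewrite !monomial_apply_cons IHr mnmDE iterD; congr iter.
elim: (fun_of_multinom m2 j) => //= k ->.
by rewrite monomial_apply_comm.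
Qed.

Lemma poly_applyM p q x : poly_apply V (p * q) x = poly_apply V p (poly_apply V q x).
Proof.
elim/mpolyind: p => [|a m p _ _ IHp]; first by rewrite mul0r !poly_apply0.
rewrite mulrDl !poly_applyD IHp -scalerAl !poly_applyZ; congr (_ *: _ + _).
elim/mpolyind: q {IHp} => [|b l q _ _ IHq]; first by rewrite mulr0 !poly_apply0 linear0.
rewrite mulrDr !poly_applyD IHq linearD /= -scalerAr !poly_applyZ linearZ /=;
  congr (_ *: _ + _).
by rewrite -mpolyXD !poly_apply_mon monomial_applyD.
Qed.

Lemma annihilator_ideal (K : set H) : is_ideal (annihilator V K).
Proof.
split.
- by move=> x _; rewrite poly_apply0.
- by move=> p q Kp Kq x Kx; rewrite poly_applyD Kp // Kq // addr0.
- by move=> p q Kq x Kx; rewrite poly_applyM Kq // linear0.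
Qed.

Lemma poly_apply_invariant (K : set H) p x : closed_subspace K ->
  (forall i x, K x -> K (V i x)) -> K x -> K (poly_apply V p x).
Proof.
move=> sK KV Kx; apply: subspace_sum => // m _; apply: subspaceZ => //.
rewrite -/(monomial_apply _ _ _); elim: (index_enum _) => [|i r IHr].
  by rewrite /monomial_apply big_nil.
by rewrite monomial_apply_cons; elim: (fun_of_multinom m i) => //= k; apply: KV.
Qed.

Lemma adjointable_poly_apply (dot : {dot H for Num.conj}) :
  (forall i, adjointable dot (V i)) -> forall p, adjointable dot (poly_apply V p).
Proof.
move=> aV; elim/mpolyind => [|a m p _ _ [S HS]].
  by exists (fun=> 0) => x y; rewrite poly_apply0 dot0l dot0r.
have [T HT] : adjointable dot (monomial_apply (index_enum 'I_n) m).
  elim: (index_enum 'I_n) => [|i r [T HT]].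
    by exists idfun => x y; rewrite /monomial_apply big_nil.
  have [S' HS'] := adjointable_iter (fun_of_multinom m i) (aV i).
  by exists (T \o S') => x y; rewrite monomial_apply_cons HS' HT.
have [U HU] := adjointable_lincomb a (ex_intro _ T HT) (ex_intro _ S HS).
by exists U => x y; rewrite poly_applyD poly_applyZ poly_apply_mon HU.
Qed.

End PolyApply.

(** * Bivariate polynomials at a line *)

Section Bivariate.
Variable C : numClosedFieldType.
Implicit Types (F G : {poly {poly C}}) (f g c : {poly C}) (a b : C).

(** The outer variable is [y]: [at_x a F] is the restriction of [F] to the line
    [x = a]. *)
Definition at_x a F : {poly C} := map_poly (horner_eval a) F.
Definition in_y g : {poly {poly C}} := map_poly polyC g.

HB.instance Definition _ a := GRing.RMorphism.copy (at_x a) (map_poly (horner_eval a)).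
HB.instance Definition _ := GRing.RMorphism.copy in_y (map_poly polyC).

Lemma horner_at_x a b F : (at_x a F).[b] = F.[b%:P].[a].
Proof. exact: horner_map_eval. Qed.

Lemma at_xC a c : at_x a c%:P = (c.[a])%:P.
Proof. exact: map_polyC. Qed.

Lemma at_xY a : at_x a 'X = 'X.
Proof. exact: map_polyX. Qed.

Lemma in_yC b : in_y b%:P = b%:P%:P.
Proof. exact: map_polyC. Qed.

Lemma in_yY : in_y 'X = 'X.
Proof. exact: map_polyX. Qed.

Lemma x_split a F : exists G, F = in_y (at_x a F) + ('X%:P - a%:P%:P) * G.
Proof.
elim/poly_ind: F => [|F c [G EG]].
  by exists 0; rewrite !rmorph0 mulr0 addr0.
have [c' Ec] : exists c', c = (c.[a])%:P + ('X - a%:P) * c'.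
  have /factor_theorem[c' Ec] : root (c - (c.[a])%:P) a by rewrite rootE !hornerE subrr.
  by exists c'; rewrite mulrC -Ec addrC subrK.
exists (G * 'X + c'%:P).
have -> : in_y (at_x a (F * 'X + c%:P)) = in_y (at_x a F) * 'X + (c.[a])%:P%:P.
  by rewrite 2!rmorphD 2!rmorphM /= at_xC at_xY in_yC in_yY.
have {1}-> : c%:P = (c.[a])%:P%:P + ('X%:P - a%:P%:P) * c'%:P.
  by rewrite [in LHS]Ec polyCD polyCM polyCB.
by rewrite {1}EG; ring.
Qed.

Lemma at_x_eq0 a F : at_x a F = 0 -> exists G, F = ('X%:P - a%:P%:P) * G.
Proof. by move=> F0; have [G EG] := x_split a F; exists G; rewrite EG F0 rmorph0 add0r. Qed.

Lemma XsubC_neq0 a : 'X%:P - a%:P%:P != 0 :> {poly {poly C}}.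
Proof. by rewrite -polyCB polyC_eq0 polyXsubC_eq0. Qed.

(** Gauss's lemma at one place: a denominator cannot hide a zero of [q]. *)
Lemma zero_of_multiple a b c F G q : c != 0 -> c%:P * F = G * q -> at_x a q != 0 ->
  q.[b%:P].[a] = 0 -> F.[b%:P].[a] = 0.
Proof.
move: {2}(size c) (leqnn (size c)) => m; elim: m c G => [|m IHm] c G.
  by rewrite leqn0 size_poly_eq0 => ->.
move=> cm c0 E qa qab; have [ca|ca] := eqVneq c.[a] 0.
  have /factor_theorem[c' Ec] : root c a by rewrite rootE ca.
  have /at_x_eq0[G' EG] : at_x a G = 0.
    have /eqP := congr1 (at_x a) E; rewrite !rmorphM /= at_xC ca polyC0.
    by rewrite mul0r eq_sym mulf_eq0 (negPf qa) orbF => /eqP.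
  have c'0 : c' != 0 by apply: contraNneq c0 => c'0; rewrite Ec c'0 mul0r.
  apply: (IHm c' G') => //.
    by move: cm; rewrite Ec size_Mmonic ?monicXsubC // size_XsubC addn2.
  apply: (mulfI (XsubC_neq0 a)); rewrite [RHS]mulrA -EG -E Ec polyCM polyCB; ring.
have /(congr1 (fun P => P.[b%:P].[a])) := E.
rewrite !hornerE qab mulr0 => /eqP.
by rewrite mulf_eq0 (negPf ca) => /eqP.
Qed.

End Bivariate.

(** * Pairs of commuting shifts *)

(** An action of the bivariate polynomials by polynomials in two commuting
    isometries. Exchanging the variables gives another one. *)
Record pair_action (R : realType) (H : completeNormedModType R[i])
    (dot : {dot H for Num.conj}) (act : {poly {poly R[i]}} -> {linear H -> H}) : Prop :=
  PairAction {
    pair_actD : forall F G x, act (F + G) x = act F x + act G x;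
    pair_actM : forall F G x, act (F * G) x = act F (act G x);
    pair_actC : forall a x, act a%:P%:P x = a *: x;
    pair_adj : forall F, adjointable dot (act F);
    pair_isoX : isometry_on (act 'X%:P) setT;
    pair_isoY : isometry_on (act 'X) setT }.

(** For an isometry [T] that preserves [K], the restriction to [K] is a shift. *)
Definition pure_on (R : realType) (H : completeNormedModType R[i]) (T : H -> H) (K : set H) :=
  forall x, (forall k, exists2 y, K y & iter k T y = x) -> x = 0.

Section PairAction.
Variables (R : realType) (H : completeNormedModType R[i]).
Variable dot : {dot H for Num.conj}.
Hypothesis Hdot : norm_from_dot dot.
Local Notation C := R[i].
Variable act : {poly {poly C}} -> {linear H -> H}.
Hypothesis actP : pair_action dot act.
Local Notation X := (act 'X%:P).
Local Notation Y := (act 'X).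
Implicit Types (x y z u v w m e : H) (K L M : set H) (a b c : C) (F G : {poly {poly C}}).
Implicit Types (f g : {poly C}).

Let actD := pair_actD actP.
Let actM := pair_actM actP.
Let actC := pair_actC actP.

Lemma act0 x : act 0 x = 0.
Proof. by rewrite -polyC0 -polyC0 actC scale0r. Qed.

Lemma act1 x : act 1 x = x.
Proof. by rewrite -polyC1 -polyC1 actC scale1r. Qed.

Lemma actN F x : act (- F) x = - act F x.
Proof. by apply/eqP; rewrite -addr_eq0 -actD addNr act0. Qed.

Lemma actB F G x : act (F - G) x = act F x - act G x.
Proof. by rewrite actD actN. Qed.

Lemma actZ F a x : act F (a *: x) = a *: act F x.
Proof. exact: linearZ. Qed.

Lemma act_comm F G x : act F (act G x) = act G (act F x).
Proof. by rewrite -!actM mulrC. Qed.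

Lemma act_sum (I : Type) (r : seq I) (Q : pred I) (F : I -> {poly {poly C}}) x :
  act (\sum_(i <- r | Q i) F i) x = \sum_(i <- r | Q i) act (F i) x.
Proof.
by elim/big_rec2: _ => [|i y G _ <-]; [rewrite act0|rewrite actD].
Qed.

Lemma act_XsubC a x : act ('X%:P - a%:P%:P) x = X x - a *: x.
Proof. by rewrite actB actC. Qed.

Lemma act_YsubC a x : act ('X - a%:P%:P) x = Y x - a *: x.
Proof. by rewrite actB actC. Qed.

Lemma dotX x y : dot (X x) (X y) = dot x y.
Proof. exact: (isometry_dot Hdot (whole_subspace H) (pair_isoX actP) I I). Qed.

Lemma dotY x y : dot (Y x) (Y y) = dot x y.
Proof. exact: (isometry_dot Hdot (whole_subspace H) (pair_isoY actP) I I). Qed.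

(** An eigenvector lies in the range of every power. *)
Lemma pure_no_eigenvector (T : {linear H -> H}) K c x : closed_subspace K ->
  isometry_on T setT -> pure_on T K -> K x -> T x = c *: x -> x = 0.
Proof.
move=> sK isoT pT Kx Tx; have [c0|c0] := eqVneq c 0.
  by apply: (isometry_injective isoT (K := setT)) => //; rewrite Tx c0 scale0r.
apply: pT => k; exists ((c^-1 ^+ k) *: x); first exact: subspaceZ.
elim: k => [|k IHk]; first by rewrite scale1r.
by rewrite iterSr linearZ /= Tx scalerA exprS mulrAC mulVf // mul1r.
Qed.

(** An isometry perturbed by a strict contraction is bounded below, here by
    [1 - |c|]. *)
Lemma closed_image_perturbation (T L1 L2 : {linear H -> H}) c M : closed_subspace M ->
  isometry_on L1 setT -> isometry_on L2 setT -> `|c| < 1 ->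
  (forall x, T x = L1 x - c *: L2 x) -> closed_subspace (T @` M).
Proof.
move=> sM iso1 iso2 c1 TE.
have [r r0 Er] : exists2 r : R, 0 <= r & `|c| = r%:C%C.
  exists (complex.Re `|c|); last by rewrite RRe_real // normr_real.
  by rewrite -lecR RRe_real ?normr_real ?normr_ge0.
have r1 : r < 1 by rewrite -ltcR -Er.
have d0 : 0 < 1 - r by rewrite subr_gt0.
apply: (@closed_image R H T (1 + r) (1 - r)^-1 M) => //; first by rewrite invr_gt0.
  move=> x; rewrite TE; apply: le_trans (ler_normB _ _) _.
  by rewrite normrZ iso1 // iso2 // Er rmorphD rmorph1 mulrDl mul1r.
move=> x _; rewrite fmorphV /= mulrC ler_pdivlMr ?ltcR // TE.
have -> : ((1 - r)%:C)%C = 1 - `|c| by rewrite Er rmorphB rmorph1.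
rewrite mulrBr mulr1 mulrC -{1}(iso1 x) // -(iso2 x) // -normrZ.
exact: lerB_dist.
Qed.

(** ** The wandering subspace of an invariant subspace *)

Variable K : set H.
Hypothesis sK : closed_subspace K.
Hypothesis KX : pure_on X K.
Hypothesis KY : pure_on Y K.
Hypothesis Kinv : forall F x, K x -> K (act F x).

Lemma act_x_inj f x : f != 0 -> K x -> act f%:P x = 0 -> x = 0.
Proof.
have [r ->] := closed_field_poly_normal f.
rewrite scaler_eq0 negb_or => /andP[l0 _] Kx; rewrite -mul_polyC polyCM actM actC.
move/eqP; rewrite scaler_eq0 (negPf l0) => /eqP {l0}.
elim: r => [|c r IHr]; first by rewrite big_nil polyC1 act1.
rewrite big_cons polyCM actM polyCB act_XsubC => /subr0_eq E; apply: IHr.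
by apply: (pure_no_eigenvector sK (pair_isoX actP) KX _ E); apply: Kinv.
Qed.

Section Invariant.
Variable M : set H.
Hypothesis sM : closed_subspace M.
Hypothesis MK : M `<=` K.
Hypothesis Minv : forall F x, M x -> M (act F x).

(** The orthogonal complement of [X M] in [M]; as [X] is a shift, [M] is the
    orthogonal sum of the levels [X^k] of this subspace. *)
Definition wandering x := M x /\ forall m, M m -> dot x (X m) = 0.

Lemma wandering_lincomb a x y : wandering x -> wandering y -> wandering (a *: x + y).
Proof.
move=> [Mx xX] [My yX]; split; first exact: subspaceP.
by move=> m Mm; rewrite dotDl dotZl xX // yX // mulr0 addr0.
Qed.

Lemma wandering0 : wandering 0.
Proof. by split; [apply: subspace0|move=> m _; rewrite dot0l]. Qed.

Lemma wandering_sum r (c : 'I_r -> C) (e : 'I_r -> H) :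
  (forall i, wandering (e i)) -> wandering (\sum_i c i *: e i).
Proof.
move=> eW; apply: big_ind => [||i _]; first exact: wandering0.
  by move=> x y wx wy; rewrite -[x]scale1r; apply: wandering_lincomb.
by rewrite -[_ *: _]addr0; apply: wandering_lincomb => //; apply: wandering0.
Qed.

Lemma wold_step x : M x -> exists e m, [/\ wandering e, M m & x = e + X m].
Proof.
move=> Mx; have sXM := closed_image_isometry sM (pair_isoX actP).
have [_ [m Mm <-] xm] := orthogonal_projection Hdot x sXM.
exists (x - X m), m; split=> //; last by rewrite subrK.
split; first by apply: subspaceB => //; apply: Minv.
by move=> m' Mm'; apply: xm; exists m'.
Qed.

Lemma contraction_null a m m' : `|a| < 1 -> `|m'| = `|m| ->
  dot m m = a * dot m m' -> m = 0.
Proof.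
move=> a1 m'm mm; apply/eqP; rewrite -normr_eq0; apply: contraTT a1 => m0.
have m0' : 0 < `|m| ^+ 2 by rewrite exprn_gt0 // lt_def m0 normr_ge0.
rewrite -real_leNgt ?normr_real ?real1 // -(ler_pM2r m0') mul1r.
have : `|dot m m| <= `|a| * `|m| ^+ 2.
  rewrite {1}mm normrM; apply: ler_wpM2l => //.
  by apply: le_trans (cauchy_schwarz Hdot _ _) _; rewrite m'm expr2.
by rewrite -Hdot ger0_norm // ltW.
Qed.

Lemma wandering_disjoint a e : `|a| < 1 -> wandering e ->
  (act ('X%:P - a%:P%:P) @` M) e -> e = 0.
Proof.
move=> a1 [Me eX] [m Mm Em].
suff m0 : m = 0 by rewrite -Em m0 linear0.
apply: (@contraction_null a _ (X m)) => //; first exact: (pair_isoX actP).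
by have /eqP := eX _ Mm; rewrite -Em act_XsubC dotBl dotZl dotX subr_eq0 => /eqP.
Qed.

Lemma range_X_subspace a : `|a| < 1 -> closed_subspace (act ('X%:P - a%:P%:P) @` M).
Proof.
move=> a1; apply: (@closed_image_perturbation _ X idfun a) => //; last exact: act_XsubC.
exact: (pair_isoX actP).
Qed.

Lemma range_X_invariant a F x : (act ('X%:P - a%:P%:P) @` M) x ->
  (act ('X%:P - a%:P%:P) @` M) (act F x).
Proof. by move=> [m Mm <-]; exists (act F m); [apply: Minv|rewrite act_comm]. Qed.

(** Orthogonality to the range gives [dot (Y w) w = b * dot w w]. With
    [1 <= |b|] this is the equality case of the Cauchy-Schwarz inequality, so
    [w] is an eigenvector of the shift [Y]. *)
Lemma dense_range_Y b w : 1 <= `|b| -> M w ->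
  (forall m, M m -> dot (act ('X - b%:P%:P) m) w = 0) -> w = 0.
Proof.
move=> b1 Mw /(_ w Mw)/eqP; rewrite act_YsubC dotBl dotZl subr_eq0 => /eqP Yww.
have [->//|w0] := eqVneq w 0.
have ww : 0 < dot w w by rewrite dnorm_gt0.
have bE : `|b| = 1.
  apply/eqP; rewrite eq_le b1 andbT -(ler_pM2r ww) mul1r.
  have := cauchy_schwarz Hdot (Y w) w.
  by rewrite Yww (pair_isoY actP) // normrM -expr2 Hdot [`|dot w w|]ger0_norm // ltW.
apply: (pure_no_eigenvector sK (pair_isoY actP) KY (MK Mw) (c := b)).
apply/eqP; rewrite -subr_eq0 -(dnorm_eq0 dot).
have bb : b * b^* = 1 by rewrite -normCK bE expr1n.
rewrite !(dotBl, dotBr, dotZl, dotZr) dotY (dotC dot w (Y w)) Yww rmorphM /=.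
have -> : (dot w w)^* = dot w w by rewrite -dotC.
set t := dot w w; apply/eqP.
transitivity (t - b * b^* * t); first by ring.
by rewrite bb mul1r subrr.
Qed.

(** The range of [Y - b] is dense in [M]. Since [G] has an adjoint, what it does
    on that range determines whether it maps [M] into the closed [L]. *)
Lemma cancel_YsubC b L G : 1 <= `|b| -> closed_subspace L ->
  (forall m, M m -> L (act (('X - b%:P%:P) * G) m)) -> forall m, M m -> L (act G m).
Proof.
move=> b1 sL LG m Mm; apply: (orthocomplementK Hdot sL) => w wL.
have [T GT] := pair_adj actP G.
have [w' Mw' ww'] := orthogonal_projection Hdot (T w) sM.
have E x : M x -> dot x w' = dot (act G x) w.
  move=> Mx; rewrite GT -[T w in RHS](subrK w') dotDr.
  by rewrite (dot_sym0 (ww' x Mx)) add0r.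
rewrite -E // (_ : w' = 0) ?dot0r //.
apply: (dense_range_Y b1 Mw') => x Mx; rewrite E; last exact: Minv.
by apply: dot_sym0; apply: wL; rewrite -actM mulrC; apply: LG.
Qed.

Variable h : {poly {poly C}}.
Hypothesis hM : forall m, M m -> act h m = 0.

Lemma at_x_range a m : M m -> (act ('X%:P - a%:P%:P) @` M) (act (in_y (at_x a h)) m).
Proof.
move=> Mm; have [G EG] := x_split a h; exists (act (- G) m); first exact: Minv.
have E : ('X%:P - a%:P%:P) * - G = in_y (at_x a h) - h.
  by move: EG; move: (in_y _) => t ->; ring.
by rewrite -actM E actB hM // subr0.
Qed.

(** A power of [y - b] times some [g] with [g b <> 0] sends [M] into [(X - a) M];
    the power can be cancelled, and [g] is invertible modulo [y - b]. *)
Lemma quotient_injective a b m : `|a| < 1 -> 1 <= `|b| -> at_x a h != 0 -> M m ->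
  (act ('X%:P - a%:P%:P) @` M) (act ('X - b%:P%:P) m) ->
  (act ('X%:P - a%:P%:P) @` M) m.
Proof.
move=> a1 b1 ha Mm; set L := _ @` _ => Lm.
have sL : closed_subspace L by apply: range_X_subspace.
have [k [g [gb Eg]]] : exists k g, ~~ root g b /\ at_x a h = g * ('X - b%:P) ^+ k.
  by have [k [g gb ->]] := multiplicity_XsubC (at_x a h) b; exists k, g; rewrite ha in gb.
have Lg : forall x, M x -> L (act (in_y g) x).
  have : forall x, M x -> L (act (('X - b%:P%:P) ^+ k * in_y g) x).
    move=> x Mx; have := at_x_range a Mx;
      rewrite Eg -/L rmorphM rmorphXn rmorphB /= in_yC in_yY.
    by rewrite mulrC.
  elim: k {Eg} => [|k IHk]; first by rewrite mul1r.
  by move=> Lk; apply: IHk; apply: (cancel_YsubC b1 sL) => x Mx; rewrite mulrA -exprS;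
    apply: Lk.
have [g' Eg'] : exists g', g = (g.[b])%:P + g' * ('X - b%:P).
  have /factor_theorem[g' Ec] : root (g - (g.[b])%:P) b by rewrite rootE !hornerE subrr.
  by exists g'; rewrite -Ec addrC subrK.
have : L (act (in_y g) m - act (in_y g') (act ('X - b%:P%:P) m)).
  by apply: subspaceB => //; [apply: Lg|apply: range_X_invariant].
rewrite -actM -actB {1}Eg' rmorphD rmorphM rmorphB /= !in_yC in_yY addrK actC => Lgm.
rewrite -[m]scale1r -(mulVf gb) -scalerA; exact: subspaceZ.
Qed.

(** ** A finite orthonormal basis of the wandering subspace *)

Definition orthonormal_family r (e : 'I_r -> H) :=
  (forall i, wandering (e i)) /\ forall i j, dot (e i) (e j) = (i == j)%:R.

(** The Gram-Schmidt process; dependent vectors are dropped, so [r] may be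
    smaller than the size of [vs]. *)
Lemma gram_schmidt (vs : seq H) : (forall v, v \in vs -> wandering v) ->
  exists r (e : 'I_r -> H), orthonormal_family e /\
    forall x, (forall i, dot x (e i) = 0) -> forall v, v \in vs -> dot x v = 0.
Proof.
elim: vs => [|v vs IHvs] Wvs.
  by exists 0%N, (fun=> 0); split=> //; split; [move=> [] []|move=> [] []].
have [u uvs|r [e [[We ee] He]]] := IHvs _; first by apply: Wvs; rewrite inE uvs orbT.
have Wv : wandering v by apply: Wvs; rewrite inE eqxx.
pose v' := v - \sum_i dot v (e i) *: e i.
have Ev : v = v' + \sum_i dot v (e i) *: e i by rewrite subrK.
have Wv' : wandering v'.
  rewrite /v' addrC -scaleN1r; apply: wandering_lincomb => //; exact: wandering_sum.
have v'e i : dot v' (e i) = 0.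
  rewrite dotBl dot_suml (bigD1 i) //= dotZl ee eqxx mulr1 big1 ?addr0 ?subrr //.
  by move=> j ji; rewrite dotZl ee (negPf ji) mulr0.
have xv x : (forall i, dot x (e i) = 0) -> dot x v = dot x v'.
  move=> xe; rewrite {1}Ev dotDr dot_sumr big1 ?addr0 // => i _.
  by rewrite dotZr xe mulr0.
have [v'0|v'0] := eqVneq v' 0.
  exists r, e; split=> // x xe u; rewrite inE => /predU1P[->|]; last exact: He.
  by rewrite xv // v'0 dot0r.
have nv : `|v'| != 0 by rewrite normr_eq0.
pose e0 := `|v'|^-1 *: v'.
have e0v x : dot x e0 = `|v'|^-1 * dot x v'.
  by rewrite dotZr; congr (_ * _); apply: conj_Creal; rewrite rpredV normr_real.
have e0e i : dot e0 (e i) = 0 by rewrite dotZl v'e mulr0.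
exists r.+1, (fun i => oapp e e0 (unlift ord0 i)); split; first split.
- move=> i; case: unliftP => [j|] _ //=.
  by rewrite /e0 -[_ *: _]addr0; apply: wandering_lincomb => //; apply: wandering0.
- move=> i j; case: unliftP => [i'|] ->; case: unliftP => [j'|] -> //=.
  + exact: dot_sym0.
  + by rewrite e0v dotZl -Hdot expr2 [X in _ * X]mulrA mulVf // mul1r mulVf.
- move=> x xe; have xe0 : dot x e0 = 0 by have := xe ord0; rewrite unlift_none.
  have xe' i : dot x (e i) = 0 by have := xe (lift ord0 i); rewrite liftK.
  move=> u; rewrite inE => /predU1P[->|]; last exact: He.
  by rewrite xv //; move/eqP: xe0; rewrite e0v mulf_eq0 invr_eq0 (negPf nv) => /eqP.
Qed.

Variable S : seq H.
Hypothesis SM : forall s, s \in S -> M s.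
Hypothesis Sgen : forall x, M x -> (forall F s, s \in S -> dot x (act F s) = 0) -> x = 0.
Hypothesis h0 : at_x 0 h != 0.

(** Since [h (0, Y)] maps [M] into [X M], the wandering subspace is spanned by
    the projections of the vectors [Y^j s] for [j] below the degree of
    [h (0, y)]. *)
Lemma wandering_basis : exists r (e : 'I_r -> H), orthonormal_family e /\
  forall x, wandering x -> (forall i, dot x (e i) = 0) -> x = 0.
Proof.
have /choice[pr prP] x : exists e, M x -> wandering e /\ exists2 m, M m & x = e + X m.
  have [Mx|nMx] := pselect (M x); last by exists 0.
  by have [e [m [We Mm ->]]] := wold_step Mx; exists e => _; split=> //; exists m.
pose vs := [seq pr (act ('X ^+ j) s) | s <- S, j <- iota 0 (size (at_x 0 h))].
have [v|r [e [oe He]]] := @gram_schmidt vs.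
  move=> /allpairsP[[s j] /= [Ss _ ->]].
  by have [] := prP _ (Minv ('X ^+ j) (SM Ss)).
exists r, e; split=> // x [Mx xX] xe; apply: Sgen => // F s Ss.
have xXm m : M m -> dot x (act 'X%:P m) = 0 by exact: xX.
have [G ->] := x_split 0 F; rewrite actD dotDr polyC0 subr0 actM xXm ?addr0; last first.
  exact/Minv/SM.
rewrite (divp_eq (at_x 0 F) (at_x 0 h)) rmorphD rmorphM /= actD dotDr mulrC actM.
have [m Mm <-] := at_x_range 0 (Minv (in_y (at_x 0 F %/ at_x 0 h)) (SM Ss)).
rewrite polyC0 subr0 xXm // add0r.
have : (size (at_x 0 F %% at_x 0 h)%R < size (at_x 0 h))%N by rewrite ltn_modp.
move: (_ %% _) => g sg; rewrite -[g]coefK poly_def rmorph_sum act_sum dot_sumr big1 // => j _.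
rewrite -mul_polyC rmorphM rmorphXn /= in_yC in_yY actM actC dotZr.
have [_ [m' Mm' E]] := prP _ (Minv ('X ^+ j) (SM Ss)).
rewrite E dotDr xXm // addr0 (He x xe) ?mulr0 //.
apply/allpairsP; exists (s, nat_of_ord j); split=> //=.
by rewrite mem_iota add0n (leq_trans (ltn_ord j) (ltnW sg)).
Qed.

Section Basis.
Variables (r : nat) (e : 'I_r -> H).
Hypothesis e_basis : orthonormal_family e.
Hypothesis e_total : forall x, wandering x -> (forall i, dot x (e i) = 0) -> x = 0.

Lemma wandering_expand x : wandering x -> x = \sum_i dot x (e i) *: e i.
Proof.
case: e_basis => We ee Wx; apply/eqP; rewrite -subr_eq0; apply/eqP; apply: e_total.
  by rewrite addrC -scaleN1r; apply: wandering_lincomb => //; apply: wandering_sum.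
move=> i; rewrite dotBl dot_suml (bigD1 i) //= dotZl ee eqxx mulr1 big1 ?addr0 ?subrr //.
by move=> j ji; rewrite dotZl ee (negPf ji) mulr0.
Qed.

(** Splitting off one level [X^k] of the wandering subspace at a time leaves,
    after [N] steps, a remainder in [X^N M], to which [m] is orthogonal. *)
Lemma polynomial_expand N m : M m ->
  (forall m', M m' -> dot m (act ('X%:P ^+ N) m') = 0) ->
  exists g : 'I_r -> {poly C}, m = \sum_i act (g i)%:P (e i).
Proof.
elim: N m => [|N IHN] m Mm mN.
  exists (fun=> 0); rewrite big1 => [|i _]; last by rewrite act0.
  by apply: (dot_self_eq0 (dot := dot)); have := mN m Mm; rewrite expr0 act1.
have [e0 [m1 [We0 Mm1 Em]]] := wold_step Mm.
have [m' Mm'|g Eg] := IHN m1 Mm1.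
  have := mN m' Mm'; rewrite exprS actM Em dotDl dotX.
  by case: We0 => _ ->; [rewrite add0r|apply: Minv].
exists (fun i => (dot e0 (e i))%:P + 'X * g i).
rewrite Em {1}(wandering_expand We0) {1}Eg linear_sum -big_split; apply: eq_bigr => i _ /=.
by rewrite polyCD polyCM actD actC actM.
Qed.

(** Orthogonality to the level [X^k] of the wandering subspace pushes [z] from
    [X^k M] into [X^(k+1) M], and [X] is a shift. *)
Lemma basis_total z : M z ->
  (forall k i, dot z (act ('X%:P ^+ k) (e i)) = 0) -> z = 0.
Proof.
move=> Mz ze; apply: KX => k; suff [m Mm <-] : exists2 m, M m & act ('X%:P ^+ k) m = z.
  by exists m; [apply: MK|elim: k => [|k IHk]; rewrite ?expr0 ?act1 // exprS actM -IHk].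
elim: k => [|k [m Mm Em]]; first by exists z; rewrite // expr0 act1.
have [e0 [m1 [We0 Mm1 E]]] := wold_step Mm.
exists m1 => //; rewrite -Em exprSr actM E; suff -> : e0 = 0 by rewrite add0r.
apply: e_total => // i; have := ze k i; rewrite -Em.
have -> u v : dot (act ('X%:P ^+ k) u) (act ('X%:P ^+ k) v) = dot u v.
  by elim: k {Em} => [|k IHk]; rewrite ?expr0 ?act1 // exprS !actM dotX.
have Xe : dot (X m1) (e i) = 0.
  by apply: dot_sym0; case: e_basis => We _; case: (We i) => _; apply.
by rewrite E dotDl Xe addr0.
Qed.

(** The crux: with [p(x) = h(x, beta)] and [h = p + (y - beta) h1], the
    operator [G = - h1(X, Y)] satisfies [(Y - beta) G = p(X)], and [G] maps the
    wandering subspace into finitely many levels [X^k e_i] because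
    [(1 - conj beta Y) M = M]. So [G] is a matrix of polynomials in [X], and
    the determinant of [(y - beta) G(x) - p(x)] kills [M]. If the matrix were
    singular at [(a, b)], a combination [x] of the [e_i] would satisfy
    [(Y - b) G x = 0] modulo [(X - a) M]; then [G x], hence [p(X) x] and, as
    [p a <> 0], also [x] would lie in [(X - a) M], which meets the wandering
    subspace only in 0. *)
Lemma determinant_relation a b : `|a| < 1 -> 1 <= `|b| -> at_x a h != 0 ->
  exists2 chi, chi.[b%:P].[a] != 0 & forall m, M m -> act chi m = 0.
Proof.
move=> a1 b1 ha; have [We ee] := e_basis.
(* Among the points 1/2, 1/3, ... of the disc there are more than the
   polynomial [h(a, y)] has roots. *)
have [beta [beta1 hab]] : exists beta, `|beta| < 1 /\ (at_x a h).[beta] != 0.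
  pose rs := [seq (k.+2%:R)^-1 : C | k <- iota 0 (size (at_x a h))].
  have urs : uniq rs.
    rewrite map_inj_uniq ?iota_uniq // => k l /invr_inj/eqP.
    by rewrite eqr_nat => /eqP[].
  have : ~~ all (root (at_x a h)) rs.
    apply/negP => ars; have := max_poly_roots ha ars urs.
    by rewrite size_map size_iota ltnn.
  case/allPn => _ /mapP[k _ ->] nr; exists (k.+2%:R)^-1; split=> //.
  by rewrite normfV normr_nat invf_lt1 ?ltr0n // ltr1n.
pose p := h.[beta%:P]; have pa : p.[a] != 0 by rewrite -horner_at_x.
have /factor_theorem[h1 Eh1] : root (h - p%:P) beta%:P.
  by rewrite rootE !hornerE subrr.
have [G GE] : exists G, forall m, M m -> act ('X - beta%:P%:P) (act G m) = act p%:P m.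
  exists (- h1) => m Mm; rewrite -actM mulrN mulrC -Eh1 opprB actB hM // subr0 //.
pose D := act (1 - (beta^*)%:P%:P * 'X).
have DE m : D m = m - beta^* *: Y m by rewrite /D actB act1 actM actC.
have Donto m : M m -> exists2 m', M m' & D m' = m.
  move=> Mm; suff : (D @` M) m by case=> m' Mm' <-; exists m'.
  apply: (orthocomplement_within Hdot _ _ sM Mm).
  - apply: (@closed_image_perturbation _ idfun Y beta^*) => //.
      exact: (pair_isoY actP).
    by rewrite norm_conjC.
  - by move=> _ [m' Mm' <-]; apply: Minv.
  - move=> w Mw wD; apply: (@contraction_null beta _ (Y w)) => //.
      exact: (pair_isoY actP).
    have /eqP := wD (D w) (ex_intro2 _ _ w Mw erefl).
    by rewrite DE dotBr dotZr conjCK subr_eq0 => /eqP.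
pose N := size p.
have Wp k f x m : wandering x -> M m -> (size f <= k)%N -> dot (act f%:P x) (act ('X%:P
  ^+ k) m) = 0.
  move=> Wx Mm fk; rewrite -[f]coefK poly_def rmorph_sum act_sum dot_suml big1 // => j _ /=.
  rewrite -mul_polyC polyCM polyC_exp actM actC dotZl.
  have -> : k = (j + (k - j.+1).+1)%N.
    by rewrite addnS -addSn subnKC // (leq_trans (ltn_ord j)).
  rewrite (_ : dot _ _ = 0) ?mulr0 //.
  elim: (nat_of_ord j) (k - j.+1)%N => [|l IHl] q.
    by rewrite expr0 act1 exprS actM; case: Wx => _ -> //; apply: Minv.
  by rewrite addSn !exprS !actM dotX; apply: IHl.
have /choice[g Eg] j : exists gj : 'I_r -> {poly C}, act G (e j) = \sum_i act (gj i)%:P (e i).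
  apply: (@polynomial_expand N); first by apply: Minv; case: (We j).
  move=> m /Donto[m' Mm' <-]; rewrite DE linearB linearZ /= dotBr dotZr conjCK.
  rewrite (act_comm ('X%:P ^+ N)) -(dotY _ (act _ m')) -dotZl -dotBl -act_YsubC GE;
    last by case: (We j).
  by rewrite act_comm Wp //; apply: Minv.
pose A : 'M[{poly {poly C}}]_r :=
  \matrix_(j, i) (('X - beta%:P%:P) * (g j i)%:P - p%:P *+ (j == i)).
have Ae j : \sum_i act (A j i) (e i) = 0.
  transitivity (act ('X - beta%:P%:P) (act G (e j)) - act p%:P (e j)); last first.
    by rewrite GE ?subrr //; case: (We j).
  have Ajj : act (A j j) (e j) =
      act ('X - beta%:P%:P) (act (g j j)%:P (e j)) - act p%:P (e j).
    rewrite mxE eqxx mulr1n; apply: etrans (actB _ _ _) _.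
    by congr (_ - _); exact: actM.
  have Aji i : i != j ->
      act (A j i) (e i) = act ('X - beta%:P%:P) (act (g j i)%:P (e i)).
    by move=> ij; rewrite mxE eq_sym (negPf ij) mulr0n subr0 actM.
  rewrite Eg linear_sum /= [in RHS](bigD1 j) //= [in LHS](bigD1 j) //=.
  by rewrite Ajj [RHS]addrAC; congr (_ + _); apply: eq_bigr => i /Aji.
exists (\det A).
  pose ev : {rmorphism {poly {poly C}} -> C} := horner_eval a \o horner_eval b%:P.
  rewrite -[_.[a]]/(ev (\det A)) -det_map_mx; apply/negP => /det0P[c c0 cA].
  pose x := \sum_j c 0 j *: e j.
  have Wx : wandering x by apply: wandering_sum.
  have Mx : M x by case: Wx.
  suff x0 : x = 0.
    case/eqP: c0; apply/rowP => j; rewrite mxE.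
    have := congr1 (dot^~ (e j)) x0;
      rewrite dot0l /x dot_suml (bigD1 j) //= dotZl ee eqxx mulr1.
    by rewrite big1 ?addr0 // => i ij; rewrite dotZl ee (negPf ij) mulr0.
  pose L := act ('X%:P - a%:P%:P) @` M.
  have sL : closed_subspace L by apply: range_X_subspace.
  have L1 : L ((b - beta) *: act G x - act p%:P x).
    pose f i := \sum_j c 0 j *: ((b - beta) *: g j i - p *+ (j == i)).
    have -> : (b - beta) *: act G x - act p%:P x = \sum_i act (f i)%:P (e i).
      rewrite /x !linear_sum /=.  rewrite -big_split /=.
      transitivity (\sum_j \sum_i act (c 0 j *: ((b - beta) *: g j i - p *+ (j == i)))%:P
        (e i)).
        apply: eq_bigr => j _; rewrite !actZ Eg.
        have cst (t : C) q u : act (t *: q)%:P u = t *: act q%:P u.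
          by rewrite -mul_polyC polyCM actM actC.
        under [RHS]eq_bigr do rewrite cst.
        rewrite -scaler_sumr; set sg := \sum_i _; set pe := act p%:P _.
        have -> : (b - beta) *: (c 0 j *: sg) - c 0 j *: pe =
            c 0 j *: ((b - beta) *: sg - pe).
          by rewrite scalerBr !scalerA (mulrC (c 0 j)).
        congr (_ *: _); rewrite {}/sg {}/pe.
        rewrite scaler_sumr [in LHS](bigD1 j) //= [in RHS](bigD1 j) //=.
        rewrite eqxx mulr1n polyCB actB cst addrAC; congr (_ + _).
        by apply: eq_bigr => i ij; rewrite eq_sym (negPf ij) mulr0n subr0 cst.
      rewrite exchange_big; apply: eq_bigr => i _ /=; rewrite /f.
      by rewrite rmorph_sum act_sum.
    apply: subspace_sum => // i _.
    have /factor_theorem[f' ->] : root (f i) a.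
      rewrite rootE horner_sum; apply/eqP; have := congr1 (fun w : 'rV__ => w 0 i) cA.
      rewrite !mxE => E; rewrite -[RHS]E; apply: eq_bigr => j _.
      rewrite !mxE hornerZ; congr (_ * _).
      rewrite /ev /= /horner_eval !hornerE.
      by case: (j == i); rewrite ?mulr1n ?mulr0n !hornerE.
    exists (act f'%:P (e i)); first by apply: Minv; case: (We i).
    by rewrite -actM polyCM polyCB mulrC.
  have LG : L (act G x).
    apply: (quotient_injective a1 b1 ha); first exact: Minv.
    have -> : act ('X - b%:P%:P) (act G x) = - ((b - beta) *: act G x - act p%:P x).
      rewrite [LHS]act_YsubC -(GE x Mx) [X in - (_ - X)]act_YsubC.
      move: (act 'X (act G x)) (act G x) => t u.
      by rewrite opprB scalerBl opprB addrA subrK.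
    exact: subspaceN.
  have Lp : L (act p%:P x) by rewrite -(GE x Mx); apply: range_X_invariant.
  have Lx : L (p.[a] *: x).
    have /factor_theorem[p' Ep] : root (p - (p.[a])%:P) a by rewrite rootE !hornerE subrr.
    have -> : p.[a] *: x = act p%:P x - act ('X%:P - a%:P%:P) (act p'%:P x).
      by rewrite -actM mulrC -polyCB -polyCM -Ep -actB -polyCB subKr actC.
    by apply: subspaceB => //; exists (act p'%:P x) => //; apply: Minv.
  apply: (wandering_disjoint a1 Wx).
  by rewrite -[x]scale1r -(mulVf pa) -scalerA; apply: subspaceZ.
(* The matrix [A] annihilates the column of the [e_i]; multiply by its
   adjugate. *)
have chie l : act (\det A) (e l) = 0.
  transitivity (\sum_i act ((\adj A *m A) l i) (e i)).
    rewrite mul_adj_mx (bigD1 l) //= big1 ?addr0 ?mxE ?eqxx ?mulr1n // => i il.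
    by rewrite mxE eq_sym (negPf il) mulr0n act0.
  transitivity (\sum_i \sum_j act (\adj A l j) (act (A j i) (e i))).
    by apply: eq_bigr => i _; rewrite mxE act_sum; apply: eq_bigr => j _; rewrite actM.
  rewrite exchange_big big1 // => j _ /=.
  by rewrite -linear_sum Ae linear0.
move=> m Mm; apply: (dot_self_eq0 (dot := dot)); move: {2}(act _ m) => w.
have [T HT] := pair_adj actP (\det A); rewrite HT.
have [z Mz Tz] := orthogonal_projection Hdot (T w) sM.
rewrite -[T w](subrK z) dotDr (dot_sym0 (Tz m Mm)) add0r.
suff -> : z = 0 by rewrite dot0r.
apply: basis_total => // k i; apply: dot_sym0.
have Mke : M (act ('X%:P ^+ k) (e i)) by apply: Minv; case: (We i).
have := Tz _ Mke; rewrite dotBl => /subr0_eq/esym E.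
by rewrite dotC E -dotC -HT act_comm chie linear0 dot0l.
Qed.

End Basis.
End Invariant.
End PairAction.

(** * Relations between two commuting shifts *)

Section Pairs.
Variables (R : realType) (H : completeNormedModType R[i]).
Variable dot : {dot H for Num.conj}.
Hypothesis Hdot : norm_from_dot dot.
Local Notation C := R[i].
Implicit Types (x y z u v w m e : H) (K L M : set H) (a b c : C) (F G : {poly {poly C}}).
Implicit Types (f g : {poly C}).

Definition kills (act : {poly {poly C}} -> {linear H -> H}) F (S : set H) :=
  forall x, S x -> act F x = 0.

Section OnePair.
Variable act : {poly {poly C}} -> {linear H -> H}.
Hypothesis actP : pair_action dot act.
Local Notation X := (act 'X%:P).
Local Notation Y := (act 'X).

Let actD := pair_actD actP.
Let actM := pair_actM actP.
Let actC := pair_actC actP.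

Variable K : set H.
Hypothesis sK : closed_subspace K.
Hypothesis KX : pure_on X K.
Hypothesis KY : pure_on Y K.
Hypothesis Kinv : forall F x, K x -> K (act F x).

(** Factors [x - c] can be divided out, since [X - c] is injective on [K]. *)
Lemma primitive_relation F (S : set H) : S `<=` K -> F != 0 -> kills act F S ->
  exists2 G, kills act G S /\ size G = size F & forall c, at_x c G != 0.
Proof.
move=> SK; move: {2}(size (lead_coef F)) (leqnn (size (lead_coef F))) => k.
elim: k F => [|k IHk] F Fk F0 FK.
  by move: Fk; rewrite leqn0 size_poly_eq0 lead_coef_eq0 (negPf F0).
have [//|] := pselect (forall c, at_x c F != 0); first by exists F.
move=> /existsNP[c /negP/negPn/eqP/at_x_eq0[G EG]].
have G0 : G != 0 by apply: contraNneq F0 => G0; rewrite EG G0 mulr0.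
have lX : lead_coef ('X%:P - c%:P%:P : {poly {poly C}}) = 'X - c%:P.
  by rewrite -polyCB lead_coefC.
have [|x Sx|G' [G'S sG'] G'c] := IHk G _ G0.
- move: Fk; rewrite EG lead_coefM lX [_ * lead_coef G]mulrC.
  by rewrite size_Mmonic ?monicXsubC ?lead_coef_eq0 // size_XsubC addn2.
- move: (FK x Sx); rewrite EG actM (act_XsubC actP) => /subr0_eq E.
  apply: (pure_no_eigenvector sK (pair_isoX actP) KX _ E).
  by apply: Kinv; apply: SK.
exists G' => //; split=> //; rewrite sG' EG -polyCB size_Cmul // polyXsubC_eq0 //.
Qed.

(** The invariant subspace generated by [S] is taken as a double orthogonal
    complement. *)
Lemma finite_relation a b h (S : seq H) : `|a| < 1 -> 1 <= `|b| ->
    kills act h K -> (forall c, at_x c h != 0) -> (forall s, s \in S -> K s) ->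
  exists2 chi, chi.[b%:P].[a] != 0 & kills act chi [set` S].
Proof.
move=> a1 b1 hK hc SK.
pose U := [set x | exists F s, s \in S /\ x = act F s].
pose M := orthocomplement dot (orthocomplement dot U).
have sM : closed_subspace M by exact: orthocomplement_subspace.
have UM : U `<=` M by move=> x Ux w wU; apply: dot_sym0; apply: wU.
have SM s : s \in S -> M s.
  by move=> Ss; apply: UM; exists 1, s; rewrite (act1 actP).
have MK : M `<=` K.
  move=> x Mx; apply: (orthocomplementK Hdot sK) => w wK; apply: Mx.
  by move=> _ [F [s [Ss ->]]]; apply: wK; apply: Kinv; apply: SK.
have Minv F x : M x -> M (act F x).
  move=> Mx w wU; have [T HT] := pair_adj actP F; rewrite HT; apply: Mx.
  move=> _ [G [s [Ss ->]]]; apply: dot_sym0; rewrite -HT; apply: dot_sym0.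
  by rewrite -actM; apply: wU; exists (F * G), s.
have hM m : M m -> act h m = 0 by move=> /MK; apply: hK.
have Sgen x : M x -> (forall F s, s \in S -> dot x (act F s) = 0) -> x = 0.
  move=> Mx xS; apply: (dot_self_eq0 (dot := dot)); apply: Mx.
  by move=> _ [F [s [Ss ->]]]; apply: xS.
have [r [e [e_on e_total]]] := wandering_basis Hdot actP sM Minv hM SM Sgen (hc 0).
have [chi chi0 chiM] := determinant_relation Hdot actP sK KX KY sM MK Minv hM e_on
  e_total a1 b1 (hc a).
by exists chi => // s /SM; apply: chiM.
Qed.

(** Take [S] for which the least degree in [y] of a relation on [S] is as large as
    possible. Adding a vector of [K] to [S] does not raise it, so a minimal
    relation on the larger set is proportional to [q] over the fractions in
    [x], and [q] kills the new vector too. *)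
Lemma generic_finite_set h : h != 0 -> kills act h K ->
  exists (S : seq H) q, [/\ forall s, s \in S -> K s, q != 0, kills act q K &
    forall F, kills act F [set` S] -> (size F < size q)%N -> F = 0].
Proof.
move=> h0 hK.
pose big k := `[< exists2 S : seq H, forall s, s \in S -> K s &
  forall F, F != 0 -> kills act F [set` S] -> (k <= size F)%N >].
have big0 : exists k, big k by exists 0%N; apply/asboolP; exists [::].
have bigh k : big k -> (k <= size h)%N.
  by move=> /asboolP[S SK HS]; apply: HS => // s /SK; apply: hK.
case: (ex_maxnP big0 bigh) => k /asboolP[S SK HS] kmax.
have minS (S' : seq H) : (forall s, s \in S' -> K s) -> {subset S <= S'} ->
    exists2 q, q != 0 /\ kills act q [set` S'] & size q = k.
  move=> S'K SS'.
  have [|q [q0 qS'] qmin] := @minimal_size _ [set F | F != 0 /\ kills act F [set` S']].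
    by exists h; split=> // s /S'K; apply: hK.
  exists q => //; apply/eqP; rewrite eqn_leq; apply/andP; split.
    apply: kmax; apply/asboolP; exists S' => // F F0 FS'; exact: qmin.
  by apply: HS => // s Ss; apply: qS'; apply: SS'.
have [q [q0 qS] sq] := minS S SK (fun _ => id).
exists S, q; split=> //; last first.
  move=> F FS; rewrite sq => Fk; apply/eqP; apply: contraLR Fk => F0.
  by rewrite -leqNgt; apply: HS.
move=> x Kx.
have [||q' [q'0 q'S] sq'] := minS (x :: S).
- by move=> s; rewrite inE => /predU1P[->|]//; apply: SK.
- by move=> s Ss; rewrite inE Ss orbT.
have E : (lead_coef q')%:P * q - (lead_coef q)%:P * q' = 0.
  set F := _ - _; have FS : kills act F [set` S].
    move=> s Ss; have q's : act q' s = 0 by apply: q'S; apply/orP; right.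
    by rewrite /F (actB actP) !actM (qS s Ss) q's !linear0 addr0.
  apply/eqP; apply: contraT => F0; have := HS F F0 FS.
  have k0 : (0 < k)%N by rewrite -sq lt0n size_poly_eq0.
  rewrite leqNgt => /negP[]; rewrite -(prednK k0) ltnS; apply/leq_sizeP => j.
  rewrite leq_eqVlt coefB !coefCM => /predU1P[<-|kj].
    by rewrite !lead_coefE sq sq' mulrC subrr.
  rewrite prednK // in kj.
  by rewrite !nth_default ?sq ?sq' // !mulr0 subrr.
apply: (act_x_inj actP sK KX Kinv (f := lead_coef q')).
- by rewrite lead_coef_eq0.
- exact: Kinv.
rewrite -actM; move/subr0_eq: E => ->; rewrite actM (q'S x) ?linear0 //.
by apply/orP; left.
Qed.

(** The relation [chi] on the finite set [S] is a multiple, up to a denominator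
    in [x], of the relation [q] on [K], so [chi] would vanish at [(a, b)]. *)
Lemma pair_no_mixed_zero a b h : h != 0 -> kills act h K ->
    (forall F, kills act F K -> F.[b%:P].[a] = 0) ->
  `|a| < 1 -> 1 <= `|b| -> False.
Proof.
move=> h0 hK Zab a1 b1.
have [h' [h'K _] h'c] := primitive_relation (@subset_refl _ K) h0 hK.
have [S [q0 [SK q00 q0K q0min]]] := generic_finite_set h0 hK.
have [q [qK sq] qc] := primitive_relation (@subset_refl _ K) q00 q0K.
have [chi chiab chiS] := finite_relation a1 b1 h'K h'c SK.
have q_n0 : q != 0 by rewrite -size_poly_eq0 sq size_poly_eq0.
pose c := lead_coef q ^+ Pdiv.Ring.rscalp chi q.
have E : c%:P * chi = Pdiv.Ring.rdivp chi q * q.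
  rewrite mul_polyC /c Pdiv.ComRing.rdivp_eq; set r := Pdiv.Ring.rmodp _ _.
  suff -> : r = 0 by rewrite addr0.
  apply: q0min; last by rewrite -sq /r Pdiv.Ring.ltn_rmodp.
  move=> s Ss; rewrite -[r](addKr (Pdiv.Ring.rdivp chi q * q)) -Pdiv.ComRing.rdivp_eq.
  rewrite addrC (actB actP) -mul_polyC !actM (chiS s Ss) (qK s (SK s Ss)) !linear0 //.
  by rewrite addr0.
case/eqP: chiab; apply: (zero_of_multiple _ E (qc a) (Zab q qK)).
by rewrite expf_neq0 // lead_coef_eq0.
Qed.

(** Reversing the coefficients of a relation, as for the adjoint of a
    polynomial in unitaries; zeros are reflected in the unit circle. *)
Definition reflection d F G :=
  (forall x y, dot (act F x) y = dot (act ('X%:P ^+ d * 'X ^+ d) x) (act G y)) /\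
  (forall a b, a != 0 -> b != 0 ->
     G.[b%:P].[a] = (a * b) ^+ d * (F.[((b^-1)^* )%:P].[(a^-1)^*])^*).

Lemma reflectionS d F G : reflection d F G -> reflection d.+1 F ('X%:P * 'X * G).
Proof.
move=> [FG1 FG2]; split=> [x y|a b a0 b0].
  rewrite FG1 !exprS mulrACA !actM (dotX Hdot actP) (dotY Hdot actP) //.
by rewrite !hornerE FG2 // exprS mulrA.
Qed.

Lemma reflection_raise d d' F G : (d <= d')%N -> reflection d F G -> exists G',
  reflection d' F G'.
Proof.
move=> /subnK <-; elim: (d' - d)%N => [|k IHk] FG; first by exists G.
by have [G' FG'] := IHk FG; exists ('X%:P * 'X * G'); apply: reflectionS.
Qed.

Lemma reflectionD F1 F2 d1 d2 G1 G2 : reflection d1 F1 G1 -> reflection d2 F2 G2 ->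
  exists d G, reflection d (F1 + F2) G.
Proof.
move=> /(reflection_raise (leq_maxl d1 d2))[H1 [A1 B1]].
move=> /(reflection_raise (leq_maxr d1 d2))[H2 [A2 B2]].
exists (maxn d1 d2), (H1 + H2); split=> [x y|a b a0 b0].
  by rewrite !actD dotDl dotDr A1 A2.
by rewrite !hornerE B1 // B2 // -mulrDr -rmorphD.
Qed.

Lemma mulXS (A : comNzRingType) (p q : A) d :
  p ^+ d.+1 * q ^+ d.+1 = q * ((p ^+ d * q ^+ d) * p).
Proof. by rewrite !exprS; ring. Qed.

Lemma reflection_exists F : exists d G, reflection d F G.
Proof.
have cst c : reflection 0 c%:P%:P (c^* )%:P%:P.
  split=> [x y|a b _ _]; last by rewrite !hornerC mul1r.
  have -> : act ('X%:P ^+ 0 * 'X ^+ 0) x = x by rewrite !expr0 mul1r (act1 actP).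
  by rewrite (actC c x) (actC c^* y) dotZl dotZr conjCK.
have mulX d F1 G1 : reflection d F1 G1 -> reflection d.+1 (F1 * 'X%:P) ('X * G1).
  move=> [A B]; split=> [x y|a b a0 b0].
    have E : act ('X%:P ^+ d.+1 * 'X ^+ d.+1) x = Y (act ('X%:P ^+ d * 'X ^+ d) (X x)).
      transitivity (act ('X * (('X%:P ^+ d * 'X ^+ d) * 'X%:P)) x).
        by rewrite mulXS.
      by rewrite (actM 'X _ x) (actM _ 'X%:P x).
    by rewrite (actM F1 'X%:P) (actM 'X G1) E (dotY Hdot actP) A.
  rewrite !(hornerM, hornerC, hornerX) B // exprS rmorphM /= conjCK; field; exact: a0.
have mulY d F1 G1 : reflection d F1 G1 -> reflection d.+1 (F1 * 'X) ('X%:P * G1).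
  move=> [A B]; split=> [x y|a b a0 b0].
    have E : act ('X%:P ^+ d.+1 * 'X ^+ d.+1) x = X (act ('X%:P ^+ d * 'X ^+ d) (Y x)).
      transitivity (act ('X%:P * (('X%:P ^+ d * 'X ^+ d) * 'X)) x).
        by rewrite [in LHS]mulrC mulXS [in LHS](mulrC ('X ^+ d)).
      by rewrite (actM 'X%:P _ x) (actM _ 'X x).
    by rewrite (actM F1 'X) (actM 'X%:P G1) E (dotX Hdot actP) A.
  rewrite !(hornerM, hornerC, hornerX) B // exprS rmorphM /= conjCK; field; exact: b0.
elim/poly_ind: F => [|F f [d [G FG]]]; first by exists 0%N, 0; have := cst 0;
  rewrite conjC0 !polyC0.
have [d' [G' FG']] : exists d G, reflection d f%:P G.
  elim/poly_ind: f => [|f c [d' [G' FG']]]; first by exists 0%N, 0; have := cst 0;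
    rewrite conjC0 !polyC0.
  by rewrite polyCD polyCM; apply: (reflectionD (mulX _ _ _ FG') (cst c)).
exact: (reflectionD (mulY _ _ _ FG) FG').
Qed.

Lemma reflected_zero a b : a != 0 -> b != 0 ->
  (forall F, kills act F K -> F.[b%:P].[a] = 0) ->
  forall F, kills act F K -> F.[((b^-1)^* )%:P].[(a^-1)^*] = 0.
Proof.
move=> a0 b0 Zab F FK; have [d [G [A B]]] := reflection_exists F.
pose P := act ('X%:P ^+ d * 'X ^+ d).
have P0 x : P x = 0 -> x = 0.
  move=> Px; apply: (dot_self_eq0 (dot := dot)).
  have <- : dot (P x) (P x) = dot x x; last by rewrite Px dot0l.
  rewrite /P !actM; elim: d {A B P Px} => [|d IHd]; first by rewrite !expr0 !(act1 actP).
  rewrite !exprS !actM (dotX Hdot actP).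
  by rewrite !(act_comm actP ('X%:P ^+ d) 'X) (dotY Hdot actP).
have GK : kills act G K.
  move=> x Kx; apply: P0; apply: (dot_self_eq0 (dot := dot)).
  have E : P (act G x) = act G (P x) by exact: (act_comm actP).
  by rewrite [X in dot _ X]E -A FK ?dot0l //; apply: Kinv.
have := B a b a0 b0; rewrite (Zab G GK) => /esym/eqP.
rewrite mulf_eq0 expf_eq0 mulf_eq0 (negPf a0) (negPf b0) andbF /= conjC_eq0.
by move/eqP.
Qed.

End OnePair.
End Pairs.

Section Regions.
Variables (R : realType) (H : completeNormedModType R[i]).
Variable dot : {dot H for Num.conj}.
Hypothesis Hdot : norm_from_dot dot.
Local Notation C := R[i].
Implicit Types (act : {poly {poly C}} -> {linear H -> H}) (K : set H) (a b : C).

Lemma pair_action_swap act : pair_action dot act -> pair_action dot (fun F => act (swapXY F)).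
Proof.
case=> actD actM actC adj isoX isoY; split.
- by move=> F G x; rewrite rmorphD; apply: actD.
- by move=> F G x; rewrite rmorphM; apply: actM.
- by move=> a x; rewrite swapXY_polyC map_polyC; apply: actC.
- by move=> F; apply: adj.
- by rewrite swapXY_polyC map_polyX; apply: isoY.
- by rewrite swapXY_X; apply: isoX.
Qed.

(** Exchanging the two shifts excludes [|b| < 1 <= |a|]; the other mixed regions
    are reflected into the two excluded ones. *)
Lemma pair_regions act K a b h : pair_action dot act -> closed_subspace K ->
    pure_on (act 'X%:P) K -> pure_on (act 'X) K -> (forall F x, K x -> K (act F x)) ->
    h != 0 -> kills act h K ->
    (forall F, kills act F K -> F.[b%:P].[a] = 0) ->
  [\/ `|a| < 1 /\ `|b| < 1, `|a| = 1 /\ `|b| = 1 | 1 < `|a| /\ 1 < `|b|].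
Proof.
move=> actP sK KX KY Kinv h0 hK Zab.
have no1 a' b' : (forall F, kills act F K -> F.[b'%:P].[a'] = 0) ->
    `|a'| < 1 -> 1 <= `|b'| -> False.
  exact: (pair_no_mixed_zero Hdot actP sK KX KY Kinv h0 hK).
have no2 a' b' : (forall F, kills act F K -> F.[b'%:P].[a'] = 0) ->
    `|b'| < 1 -> 1 <= `|a'| -> False.
  move=> Zab'.
  have KX' : pure_on (act (swapXY 'X%:P)) K by rewrite swapXY_polyC map_polyX.
  have KY' : pure_on (act (swapXY 'X)) K by rewrite swapXY_X.
  have h'0 : swapXY h != 0 by rewrite swapXY_eq0.
  have h'K : kills (fun F => act (swapXY F)) (swapXY h) K.
    by move=> x Kx; rewrite swapXYK; apply: hK.
  apply: (pair_no_mixed_zero Hdot (pair_action_swap actP) sK KX' KY' _ h'0 h'K).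
    by move=> F x; apply: Kinv.
  by move=> F FK; rewrite -horner2_swapXY; apply: Zab'.
have refl := reflected_zero Hdot actP Kinv _ _ Zab.
have [a1|a1|a1] := real_ltgtP (normr_real a) (real1 _).
- have [b1|b1] := real_ltP (normr_real b) (real1 _); first by constructor 1.
  by case: (no1 _ _ Zab a1 b1).
- have [b1|b1|b1] := real_ltgtP (normr_real b) (real1 _).
  + by case: (no2 _ _ Zab b1 (ltW a1)).
  + constructor 3; split=> //.
  + have b0 : b != 0 by rewrite -normr_gt0 b1.
    have a0 : a != 0 by rewrite -normr_gt0 (lt_trans _ a1).
    case: (no1 _ _ (refl a0 b0)); first by rewrite norm_conjC normfV invf_lt1 // normr_gt0.
    by rewrite norm_conjC normfV b1 invr1.
- have [b1|b1|b1] := real_ltgtP (normr_real b) (real1 _).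
  + by case: (no2 _ _ Zab b1); rewrite a1.
  + have b0 : b != 0 by rewrite -normr_gt0 (lt_trans _ b1).
    have a0 : a != 0 by rewrite -normr_gt0 a1.
    case: (no2 _ _ (refl a0 b0)); first by rewrite norm_conjC normfV invf_lt1 // normr_gt0.
    by rewrite norm_conjC normfV a1 invr1.
  + by constructor 2.
Qed.

End Regions.

(** * The orthogonal decomposition *)

Section Tuple.
Variables (R : realType) (H : completeNormedModType R[i]).
Variable dot : {dot H for Num.conj}.
Hypothesis Hdot : norm_from_dot dot.
Variables (n : nat) (V : 'I_n -> {linear H -> H}).
Hypothesis V_isom : commuting_isometries V.
Local Notation C := R[i].
Implicit Types (x y u v w m : H) (K L M : set H) (a b c : C) (i j : 'I_n) (z : 'I_n -> C).

Let isoV i : isometry_on (V i) setT. Proof. by case: V_isom. Qed.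
Let V_comm i j x : V i (V j x) = V j (V i x). Proof. by case: V_isom. Qed.

Definition pair_of i j (F : {poly {poly C}}) : {linear H -> H} := poly_apply V (biv i j F).

Lemma pair_ofX i j x : pair_of i j 'X%:P x = V i x.
Proof. by rewrite /pair_of /= biv_X poly_apply_var. Qed.

Lemma pair_ofY i j x : pair_of i j 'X x = V j x.
Proof. by rewrite /pair_of /= biv_Y poly_apply_var. Qed.

Lemma adjointable_V i : adjointable dot (V i).
Proof. exact: (adjointable_isometry Hdot (isoV i)). Qed.

Lemma pair_of_action i j : pair_action dot (pair_of i j).
Proof.
split.
- by move=> F G x; rewrite /pair_of /= rmorphD poly_applyD.
- by move=> F G x; rewrite /pair_of /= rmorphM /= (poly_applyM V_comm).
- by move=> a x; rewrite /pair_of /= biv_C poly_apply_const.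
- by move=> F; apply: adjointable_poly_apply => k; apply: adjointable_V.
- by move=> x _; rewrite pair_ofX; apply: isoV.
- by move=> x _; rewrite pair_ofY; apply: isoV.
Qed.

Lemma pair_of_kills i j F x : annihilator V setT (biv i j F) -> pair_of i j F x = 0.
Proof. by apply. Qed.

Lemma pair_of_invariant i j K F x : closed_subspace K ->
  (forall i x, K x -> K (V i x)) -> K x -> K (pair_of i j F x).
Proof. by move=> sK KV Kx; apply: poly_apply_invariant. Qed.

Lemma pair_ofE i j F x : pair_of i j F x = poly_apply V (biv i j F) x.
Proof. by []. Qed.

Opaque pair_of.

Lemma dotV i x y : dot (V i x) (V i y) = dot x y.
Proof. exact: (isometry_dot Hdot (whole_subspace H) (isoV i) I I). Qed.

Lemma V_inj i x y : V i x = V i y -> x = y.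
Proof.
move=> E; apply/eqP; rewrite -subr_eq0; apply/eqP.
by apply: (isometry_injective (isoV i) (K := setT)) => //; rewrite linearB /= E subrr.
Qed.

Lemma dot_ext x y : (forall w, dot w x = dot w y) -> x = y.
Proof.
move=> E; apply/eqP; rewrite -subr_eq0; apply/eqP.
by apply: (dot_self_eq0 (dot := dot)); rewrite dotBr E subrr.
Qed.

Section WithAdjoint.
Variable S : 'I_n -> H -> H.
Hypothesis SV : forall i, adjoint dot (V i) (S i).

Lemma adjV i x : S i (V i x) = x.
Proof. by apply: dot_ext => w; rewrite -SV dotV. Qed.

Lemma adjZ i a x : S i (a *: x) = a *: S i x.
Proof. by apply: dot_ext => w; rewrite -SV !dotZr SV. Qed.

Lemma adj_comm i j x : S i (S j x) = S j (S i x).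
Proof. by apply: dot_ext => w; rewrite -!SV V_comm. Qed.

Lemma dotS i x y : dot (S i x) y = dot x (V i y).
Proof. by rewrite dotC -SV -dotC. Qed.

Lemma eigenvalue_unimodular i a x : x <> 0 -> V i x = a *: x -> `|a| = 1.
Proof.
move=> /eqP x0 Vx; have := isoV i (x := x) I; rewrite Vx normrZ => E.
have nx : `|x| != 0 by rewrite normr_eq0.
by apply: (mulIf nx); rewrite E mul1r.
Qed.

(** The inner square of [V i x - a *: x] is [(1 - |a|^2) * dot x x]. *)
Lemma adjoint_eigenvector i a x : `|a| = 1 -> S i x = a^* *: x -> V i x = a *: x.
Proof.
move=> a1 Sx; have aa : a * a^* = 1 by rewrite -normCK a1 expr1n.
apply/eqP; rewrite -subr_eq0 -(dnorm_eq0 dot); apply/eqP.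
rewrite !(dotBl, dotBr, dotZl, dotZr) dotV SV -(dotS i x x) Sx dotZl dotZr conjCK.
move: (dot x x) => t; transitivity ((1 - a * a^*) * t); first by ring.
by rewrite aa subrr mul0r.
Qed.

Definition biinvariant K := forall i x, K x -> K (V i x) /\ K (S i x).

Lemma biinvariant_reducing K : closed_subspace K -> biinvariant K ->
  tuple_reducing dot V K.
Proof.
move=> sK bK; split=> // i; split=> //.
  by move=> _ [x Kx <-]; case: (bK i x Kx).
by move=> _ [x xK <-] y Ky; rewrite SV; apply: xK; case: (bK i y Ky).
Qed.

(** An isometry does not have the eigenvalue 0, so [a = 0] can stand for the
    part of the space without eigenvectors. *)
Definition spectral_part i a : set H :=
  [set x | (a <> 0 -> V i x = a *: x) /\
           (a = 0 -> forall b y, V i y = b *: y -> dot x y = 0)].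

Lemma spectral_part_subspace i a : closed_subspace (spectral_part i a).
Proof.
have [a0|a0] := pselect (a = 0).
  have -> : spectral_part i a = orthocomplement dot [set y | exists b, V i y = b *: y].
    apply/seteqP; split=> x.
      by move=> [_ /(_ a0) Hx] y [b Vy]; apply: Hx Vy.
    by move=> Hx; split=> // _ b y Vy; apply: Hx; exists b.
  exact: orthocomplement_subspace.
have -> : spectral_part i a = [set x | - a *: x + V i x = 0].
  apply/seteqP; split=> x /=.
    by move=> [/(_ a0) -> _]; rewrite scaleNr addNr.
  by move/eqP; rewrite scaleNr addrC subr_eq0 => /eqP Vx; split.
apply: (kernel_subspace Hdot (T := fun x => - a *: x + V i x)).
exact: (adjointable_lincomb (- a) (adjointable_id dot) (adjointable_V i)).
Qed.

(** The adjoint of [V j] commutes with that of [V i], which has the same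
    eigenvectors as [V i] for eigenvalues of modulus 1, with conjugate
    eigenvalues. *)
Lemma adjoint_preserves_eigenvectors i j a x : V i x = a *: x -> V i (S j x) = a *: S j x.
Proof.
move=> Vx; have [->|/eqP x0] := eqVneq x 0.
  have -> : S j 0 = 0 by apply: dot_ext => w; rewrite -SV !dot0r.
  by rewrite linear0 scaler0.
have a1 := eigenvalue_unimodular x0 Vx.
have aa : a^* * a = 1 by rewrite mulrC -normCK a1 expr1n.
apply: adjoint_eigenvector => //; rewrite adj_comm -adjZ; congr (S j _).
by rewrite -[x in RHS](adjV i) Vx adjZ scalerA aa scale1r.
Qed.

Lemma spectral_part_biinvariant i a : biinvariant (spectral_part i a).
Proof.
have Veig j b y : V i y = b *: y -> V i (V j y) = b *: V j y.
  by move=> Vy; rewrite V_comm Vy linearZ.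
move=> j x [Hx1 Hx2]; split; split.
- by move=> /Hx1; apply: Veig.
- move=> /Hx2 Hx b y Vy; rewrite SV; apply: (Hx b).
  exact: adjoint_preserves_eigenvectors.
- by move=> /Hx1; apply: adjoint_preserves_eigenvectors.
- by move=> /Hx2 Hx b y Vy; rewrite dotS; apply: (Hx b); apply: Veig.
Qed.

Definition joint_part (z : 'I_n -> C) : set H :=
  \bigcap_(i in [set: 'I_n]) spectral_part i (z i).

Lemma joint_part_subspace z : closed_subspace (joint_part z).
Proof. by apply: closed_subspace_bigcap => i _; apply: spectral_part_subspace. Qed.

Lemma joint_part_biinvariant z : biinvariant (joint_part z).
Proof.
by move=> j x zx; split=> i _; have [] := spectral_part_biinvariant j (zx i I).
Qed.

Lemma joint_parts_orthogonal z z' : z <> z' -> forall x y,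
  joint_part z x -> joint_part z' y -> dot x y = 0.
Proof.
move=> zz' x y zx z'y; have /existsNP[i zi] : ~ forall i, z i = z' i.
  by move=> E; apply: zz'; apply/funext.
have [zx1 zx2] := zx i I; have [z'y1 z'y2] := z'y i I.
have [z0|z0] := pselect (z i = 0).
  by apply: (zx2 z0 (z' i)); apply: z'y1 => z'0; apply: zi; rewrite z0 z'0.
have [z'0|z'0] := pselect (z' i = 0).
  by apply: dot_sym0; apply: (z'y2 z'0 (z i)); apply: zx1.
have {}zx1 := zx1 z0; have {}z'y1 := z'y1 z'0.
have [->|/eqP y0] := eqVneq y 0; first by rewrite dot0r.
have a1 := eigenvalue_unimodular y0 z'y1.
have := dotV i x y; rewrite zx1 z'y1 dotZl dotZr => E.
apply: contrapT => /eqP xy; apply: zi.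
have {}E : z i * (z' i)^* = 1 by apply: (mulIf xy); rewrite mul1r -mulrA.
by rewrite -[LHS]mulr1 -(expr1n _ 2) -a1 normCK mulrCA E mulr1.
Qed.

(** Cutting a non-zero reducing subspace down to an eigenspace of each [V i]
    that has an eigenvector in it ends in one of the joint parts. *)
Lemma joint_part_meets K : closed_subspace K -> biinvariant K ->
    (exists2 x, K x & x <> 0) ->
  exists z, [/\ forall i, z i = 0 \/ `|z i| = 1 &
    exists2 x, K x /\ joint_part z x & x <> 0].
Proof.
move=> sK bK Kx.
suff [z [K' [z1 [sK' bK'] [K'K K'z] [x K'x x0]]]] : exists z K',
    [/\ forall i, z i = 0 \/ `|z i| = 1, closed_subspace K' /\ biinvariant K',
        K' `<=` K /\ (forall i, i \in enum 'I_n -> K' `<=` spectral_part i (z i)) &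
        exists2 x, K' x & x <> 0].
  exists z; split=> //; exists x => //; split; first exact: K'K.
  by move=> i _; apply: K'z => //; rewrite mem_enum.
elim: (enum 'I_n) => [|i l [z [K' [z1 [sK' bK'] [K'K K'z] K'x]]]].
  by exists (fun=> 0), K; split; [left|split|split=> // i; rewrite in_nil|].
pose z' b j := if j == i then b else z j.
have z'P b K'' : K'' `<=` K' -> K'' `<=` spectral_part i b ->
    forall j, j \in i :: l -> K'' `<=` spectral_part j (z' b j).
  move=> K''K' K''b j; rewrite inE /z'; have [->//|_ /= jl] := eqVneq j i.
  by move=> x /K''K'; apply: K'z.
have [[b [x [K'x' x0 Vx]]]|noeig] :=
    pselect (exists b x, [/\ K' x, x <> 0 & V i x = b *: x]).
  have b1 := eigenvalue_unimodular x0 Vx.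
  have bn0 : b <> 0 by move=> b0; move: b1; rewrite b0 normr0 => /esym/eqP; rewrite oner_eq0.
  exists (z' b), (K' `&` spectral_part i b); split.
  - by move=> j; rewrite /z'; case: eqP => _; [right|].
  - split; first exact: closed_subspaceI (spectral_part_subspace _ _).
    move=> j y [K'y by_]; have [? ?] := bK' j y K'y.
    by have [? ?] := spectral_part_biinvariant j by_.
  - by split; [move=> y [/K'K]|apply: z'P => y []].
  - by exists x => //; split.
exists (z' 0), K'; split=> //.
  by move=> j; rewrite /z'; case: eqP => _; [left|].
split=> //; apply: z'P => // x K'x'; split=> // _ b y Vy.
have [y' K'y' yy'] := orthogonal_projection Hdot y sK'.
have Vy' : V i y' - b *: y' = 0.
  apply: (dot_self_eq0 (dot := dot)).
  have K'd : K' (V i y' - b *: y').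
    by apply: subspaceB => //; [case: (bK' i y' K'y')|apply: subspaceZ].
  have E1 : V i y' - b *: y' = b *: (y - y') - V i (y - y') :> H.
    by rewrite scalerBr (raddfB (V i)) /= Vy opprB [RHS]addrC addrA subrK.
  rewrite {1}E1 dotBl dotZl yy' // mulr0 SV yy' ?subr0 //.
  by case: (bK' i _ K'd).
have y'0 : y' = 0.
  apply: contrapT => y'0; apply: noeig; exists b, y'; split=> //.
  exact/subr0_eq.
by apply: dot_sym0; rewrite -[y](subrK y') dotDl yy' // y'0 dot0l addr0.
Qed.

Hypothesis V_cnu : completely_non_unitary dot V.
Hypothesis V_rel : forall i j, i != j ->
  exists2 F, F != 0 & annihilator V setT (biv i j F).

Lemma iterV i k : exists T : {linear H -> H}, T =1 iter k (V i) /\ isometry_on T setT.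
Proof.
elim: k => [|k [T [ET isoT]]]; first by exists idfun.
exists (V i \o T); split=> [x|x _] /=; first by rewrite ET.
by rewrite isoV // isoT.
Qed.

Lemma iterV_comm i j k x : iter k (V i) (V j x) = V j (iter k (V i) x).
Proof. by elim: k => //= k ->; rewrite V_comm. Qed.

(** On a joint part with [z i = 0], the unitary part of [V i] would reduce the
    whole tuple to unitaries: a relation between [V i] and [V j] with
    non-zero constant coefficient in [y] shows that [V j] has dense range in
    it, as [V i] has no eigenvectors. *)
Lemma joint_part_pure z i : z i = 0 -> pure_on (V i) (joint_part z).
Proof.
move=> zi; set E := joint_part z.
have sE : closed_subspace E by apply: joint_part_subspace.
pose M := [set x | forall k, exists2 y, E y & iter k (V i) y = x].
have sM : closed_subspace M.
  have -> : M = \bigcap_(k in [set: nat]) (iter k (V i) @` E).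
    apply/seteqP; split=> x Hx k; first by move=> _; case: (Hx k) => y Ey <-; exists y.
    by have [y Ey <-] := Hx k I; exists y.
  apply: closed_subspace_bigcap => k _; have [T [ET isoT]] := iterV i k.
  by rewrite -(eq_imagel (f := T)) //; apply: closed_image_isometry.
have ME : M `<=` E by move=> x /(_ 0%N)[y Ey <-].
have MV j x : M x -> M (V j x).
  move=> Mx k; have [y Ey <-] := Mx k; exists (V j y); last exact: iterV_comm.
  by case: (joint_part_biinvariant j Ey).
have Mpre x : M x -> exists2 y, M y & V i y = x.
  move=> Mx; have [y Ey Ex] := Mx 1%N; exists y => // k.
  have [y' Ey' E'] := Mx k.+1; exists y' => //; apply: (V_inj (i := i)).
  by rewrite -Ex in E'; exact: E'.
have Minv j F x : M x -> M (pair_of i j F x).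
  by apply: pair_of_invariant => // k y; apply: MV.
have dense j (c : {poly C}) w : c != 0 -> M w ->
    (forall m, M m -> dot (pair_of i j c%:P m) w = 0) -> w = 0.
  have aP := pair_of_action i j.
  have [r ->] := closed_field_poly_normal c.
  rewrite scaler_eq0 negb_or => /andP[l0 _] Mw Hw.
  have scal l (q : {poly C}) m : pair_of i j (l *: q)%:P m = l *: pair_of i j q%:P m.
    rewrite -mul_polyC polyCM; apply: etrans (pair_actM aP l%:P%:P q%:P m) _.
    exact: (pair_actC aP l (pair_of i j q%:P m)).
  have fac b (q : {poly C}) m : pair_of i j (('X - b%:P) * q)%:P m =
      V i (pair_of i j q%:P m) - b *: pair_of i j q%:P m.
    rewrite polyCM polyCB; apply: etrans (pair_actM aP _ q%:P m) _.
    by apply: etrans (act_XsubC aP b _) _; congr (_ - _); exact: pair_ofX.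
  have {Hw} : forall m, M m -> dot (pair_of i j (\prod_(b <- r) ('X - b%:P))%:P m) w = 0.
    move=> m Mm; apply: (mulfI l0); rewrite mulr0 -dotZl; apply: etrans (Hw m Mm).
    by congr (dot _ w); apply: esym; exact: scal.
  elim: r w Mw => [|b r IHr] w Mw Hw.
    by apply: (dot_self_eq0 (dot := dot)); have := Hw w Mw; rewrite big_nil polyC1 (act1 aP).
  have [u Mu Vu] := Mpre w Mw; have Su : S i w = u by rewrite -Vu adjV.
  have w1 : S i w - b^* *: w = 0.
    apply: IHr; first by rewrite Su; exact: (subspaceB sM Mu (subspaceZ _ sM Mw)).
    move=> m Mm; have := Hw m Mm; rewrite big_cons.
    move: (\prod_(j <- r) _) => q; have -> := fac b q m.
    by rewrite dotBl dotZl SV dotBr dotZr conjCK.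
  have [b0|b0] := eqVneq b 0.
    by rewrite -Vu -Su; move/subr0_eq: w1 => ->; rewrite b0 conjC0 scale0r linear0.
  have Vw : V i w = (b^*)^-1 *: w.
    have bb : b^* != 0 by rewrite conjC_eq0.
    rewrite -{2}Vu -Su; move/subr0_eq: w1 => ->.
    by rewrite linearZ /= scalerA mulVf // scale1r.
  apply: (dot_self_eq0 (dot := dot)); have [_ Ew] := ME _ Mw i I.
  exact: Ew zi _ _ Vw.
have MVj j : V j @` M = M.
  apply/seteqP; split=> [_ [x Mx <-]|x Mx]; first exact: MV.
  have [ij|ij] := eqVneq j i; first by rewrite ij; have [y My <-] := Mpre x Mx; exists y.
  have aP := pair_of_action i j.
  have [F F0 FV] : exists2 F, F.[0] != 0 & forall m, M m -> pair_of i j F m = 0.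
    have [|F F0 FV] := @V_rel i j; first by rewrite eq_sym.
    have {FV} : forall m, M m -> pair_of i j F m = 0 by move=> m _; apply: pair_of_kills.
    move: {2}(size F) (leqnn (size F)) => k; elim: k F F0 => [|k IHk] F F0 Fk FM.
      by move: Fk; rewrite leqn0 size_poly_eq0 (negPf F0).
    have [F00|] := eqVneq F.[0] 0; last by exists F.
    have /factor_theorem[G EG] : root F 0 by rewrite rootE F00.
    rewrite subr0 in EG.
    have G0 : G != 0 by apply: contraNneq F0 => G0; rewrite EG G0 mul0r.
    apply: (IHk G G0); first by move: Fk; rewrite EG size_mulX.
    move=> m Mm; have := FM m Mm; rewrite EG mulrC (pair_actM aP) pair_ofY => Vm.
    by apply: (V_inj (i := j)); rewrite Vm linear0.
  have /factor_theorem[G EG] : root (F - (F.[0])%:P) 0 by rewrite rootE !hornerE subrr.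
  rewrite subr0 in EG.
  apply: (orthocomplement_within Hdot _ _ sM Mx).
  - exact: (closed_image_isometry sM (isoV j)).
  - by move=> _ [y My <-]; apply: MV.
  - move=> w Mw wV; apply: (dense j F.[0]) => // m Mm.
    have -> : pair_of i j (F.[0])%:P m = V j (- pair_of i j G m).
      have := congr1 (fun P => pair_of i j P m) EG.
      rewrite /= mulrC (pair_actM aP) pair_ofY (actB aP) FV // sub0r => E'.
      by rewrite linearN /= -E' opprK.
    apply: dot_sym0; apply: wV; exists (- pair_of i j G m) => //.
    exact: (subspaceN sM (Minv _ _ _ Mm)).
move=> x Mx; apply: contrapT => x0; apply: V_cnu; exists M; split.
- split=> // j; split=> //; first by rewrite MVj.
  move=> _ [y yM <-] m; rewrite -{1}(MVj j) => -[m' Mm' <-].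
  by rewrite dotV; apply: yM.
- by move=> M0; apply: x0; have : M x := Mx; rewrite M0.
- by move=> j; split; [move=> y _; apply: isoV|].
Qed.

(** If no [z i] is 0, then all the [V i] are scalars of modulus 1 on the joint
    part. *)
Lemma joint_part_nonunitary z : joint_part z <> [set 0] -> exists i, z i = 0.
Proof.
move=> z0; apply: contrapT => /forallNP zn; apply: V_cnu; exists (joint_part z); split=> //.
  exact: biinvariant_reducing (joint_part_subspace z) (@joint_part_biinvariant z).
move=> i; split; first by move=> x _; apply: isoV.
apply/seteqP; split=> [_ [x zx <-]|x zx]; first by case: (joint_part_biinvariant i zx).
have [/(_ (zn i)) Vx _] := zx i I; exists ((z i)^-1 *: x).
  exact: (subspaceZ _ (joint_part_subspace z) zx).
by rewrite linearZ /= Vx scalerA mulVf ?scale1r //; apply/eqP.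
Qed.

End WithAdjoint.
End Tuple.

(** * Adjoining constant coordinates *)

Lemma mpoly_gen_ind (n : nat) (A : comNzRingType) (P : mpoly n A -> Prop) :
  (forall a, P (mpolyC n a)) -> (forall i, P (mpolyX A (mnm1 i))) ->
  (forall p q, P p -> P q -> P (p + q)) -> (forall p q, P p -> P q -> P (p * q)) ->
  forall p, P p.
Proof.
move=> PC PX PD PM; elim/mpolyind => [|a m p _ _ Pp]; first by rewrite -mpolyC0.
apply: PD => //; rewrite -mul_mpolyC; apply: (PM) => //; rewrite mpolyXE_id.
apply: big_ind => [||i _]; [by rewrite -mpolyC1|exact: PM|].
by elim: (fun_of_multinom m i) => [|k IHk]; rewrite ?expr0 -?mpolyC1 // exprS; apply: PM.
Qed.

Section Glue.
Variables (C : numClosedFieldType) (n s t : nat).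
Variables (sigma : 'I_(s + t) -> 'I_n) (tau : 'I_n -> 'I_(s + t)).
Hypothesis sigmaK : cancel sigma tau.
Variable z : 'I_n -> C.
Local Notation var := (fun i => mpolyX C (mnm1 i)).
Implicit Types (w : 'I_s -> C) (x : 'I_n -> C).

(** [glue] embeds [C^s] in [C^n] by adjoining the non-zero coordinates of [z];
    [head] is a left inverse. *)
Definition glue w : 'I_n -> C :=
  fun i => match fintype.split (tau i) with inl k => w k | inr _ => z i end.

Definition head x : 'I_s -> C := fun k => x (sigma (lshift t k)).

Lemma split_lshift (k : 'I_s) : fintype.split (lshift t k) = inl k.
Proof.
case: fintype.splitP => [j /= /val_inj<-//|j /= E].
by have := ltn_ord k; rewrite E ltnNge leq_addr.
Qed.

Lemma split_rshift (j : 'I_t) : fintype.split (rshift s j) = inr j.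
Proof.
case: fintype.splitP => [k /= E|k /= /addnI/val_inj<-//].
by have := ltn_ord k; rewrite -E ltnNge leq_addr.
Qed.

Lemma glueK w : head (glue w) = w.
Proof. by apply/funext => k; rewrite /head /glue sigmaK split_lshift. Qed.

(** The pullbacks of polynomials along [glue] and [head]. *)
Definition pull_glue : {rmorphism mpoly n C -> mpoly s C} :=
  mmap (@mpolyC s C)
    (fun i => match fintype.split (tau i) with inl k => var k | inr _ => mpolyC s (z i) end).

Definition pull_head : {rmorphism mpoly s C -> mpoly n C} :=
  mmap (@mpolyC n C) (fun k => var (sigma (lshift t k))).

Lemma pull_glueC a : pull_glue (mpolyC n a) = mpolyC s a.
Proof. exact: mmapC. Qed.

Lemma pull_glueX i : pull_glue (var i) =
  match fintype.split (tau i) with inl k => var k | inr _ => mpolyC s (z i) end.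
Proof. by rewrite [LHS]mmapX mmap1U. Qed.

Lemma pull_headC a : pull_head (mpolyC s a) = mpolyC n a.
Proof. exact: mmapC. Qed.

Lemma pull_headX k : pull_head (var k) = var (sigma (lshift t k)).
Proof. by rewrite [LHS]mmapX mmap1U. Qed.

Lemma meval_glue w p : meval (glue w) p = meval w (pull_glue p).
Proof.
apply: (mpoly_rmorph_eq (f := meval (glue w)) (g := meval w \o pull_glue)) => [a|i] /=.
  by rewrite pull_glueC !mevalC.
by rewrite pull_glueX mevalXU /glue; case: fintype.split => k; rewrite ?mevalXU ?mevalC.
Qed.

Lemma meval_head x q : meval (head x) q = meval x (pull_head q).
Proof.
apply: (mpoly_rmorph_eq (f := meval (head x)) (g := meval x \o pull_head)) => [a|i] /=.
  by rewrite pull_headC !mevalC.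
by rewrite pull_headX !mevalXU.
Qed.

(** The image is cut out by the pullbacks along [head] and the equations
    [glue (head x) = x]. *)
Lemma glue_irreducible Y : irreducible_variety Y -> irreducible_variety (glue @` Y).
Proof.
move=> [[S ->] [w Yw] Yirr]; split.
- exists ([set pull_head q | q in S] `|` [set p | exists i, p = var i - pull_head
    (pull_glue (var i))]).
  apply/seteqP; split=> [_ [u uS <-] p|x xS].
    move=> [[q Sq <-]|[i ->]]; first by rewrite -meval_head glueK; apply: uS.
    by rewrite rmorphB /= -meval_head glueK -meval_glue subrr.
  have gx : glue (head x) = x.
    apply/funext => i; apply/eqP; rewrite eq_sym -subr_eq0; apply/eqP.
    have /(_ (or_intror (ex_intro _ i erefl))) := xS (var i - pull_head (pull_glue (var i))).
    by rewrite rmorphB /= -meval_head -meval_glue !mevalXU.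
  exists (head x) => // q Sq; rewrite meval_head; apply: xS; left; by exists q.
- by exists (glue w), w.
- move=> _ _ [S1 ->] [S2 ->] cov.
  have pre S' : [set u | zero_set S' (glue u)] = zero_set [set pull_glue p | p in S'].
    apply/seteqP; split=> [u uS' _ [p Sp <-]|u uS' p Sp].
      by rewrite -meval_glue; apply: uS'.
    by rewrite meval_glue; apply: uS'; exists p.
  have [||u Yu||] := Yirr [set u | zero_set S1 (glue u)] [set u | zero_set S2 (glue u)].
  + by rewrite pre; eexists.
  + by rewrite pre; eexists.
  + by apply: cov; exists u.
  + by move=> H1; left => _ [u Yu <-]; apply: H1.
  + by move=> H2; right => _ [u Yu <-]; apply: H2.
Qed.

Lemma glue_chain Y Z d : (forall w, Y w -> Z (glue w)) ->
  irreducible_chain Y d -> irreducible_chain Z d.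
Proof.
move=> YZ [c [cY cS]]; exists (fun k => glue @` c k); split=> k kd.
  have [ck ckY] := cY k kd; split; first exact: glue_irreducible.
  by move=> _ [w cw <-]; apply/YZ/ckY.
have [sub nsub] := cS k kd; split; first exact: image_subset.
move=> H; apply: nsub => w cw; have [w' cw' E] : (glue @` c k) (glue w) by apply: H; exists w.
by rewrite -(glueK w) -E glueK.
Qed.

End Glue.

Lemma sort_zeros (C : numClosedFieldType) (n : nat) (z : 'I_n -> C) (s : nat) :
  #|[set i | z i == 0]%SET| = s ->
  exists sigma : 'I_(s + (n - s)) -> 'I_n,
    [/\ bijective sigma, forall k, z (sigma (lshift (n - s) k)) = 0 &
        forall j, z (sigma (rshift s j)) <> 0].
Proof.
move=> <-; set A := [set i | _]%SET.
have AC : (#|A| + #|~: A|)%N = n by rewrite cardsC card_ord.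
have cC : (n - #|A| = #|~: A|)%N.
  by apply: (@addnI #|A|); rewrite AC subnKC // -[X in (_ <= X)%N]AC leq_addr.
pose sigma (u : 'I_(#|A| + (n - #|A|))) : 'I_n := match fintype.split u with
  | inl k => enum_val k
  | inr j => enum_val (cast_ord cC j) end.
have A0 (k : 'I_#|A|) : z (enum_val k) = 0.
  by have := enum_valP k; rewrite finset.inE => /eqP.
have A1 (k : 'I_#|~: A|%SET) : z (enum_val k) <> 0.
  by have := enum_valP k; rewrite !finset.inE => /eqP.
have sl k : sigma (lshift _ k) = enum_val k by rewrite /sigma split_lshift.
have sr j : sigma (rshift _ j) = enum_val (cast_ord cC j) by rewrite /sigma split_rshift.
exists sigma; split; last 1 first.
- by move=> j; rewrite sr.
- apply: inj_card_bij; last first.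
    by rewrite !card_ord subnKC // -[X in (_ <= X)%N]card_ord max_card.
  move=> u v; rewrite /sigma; case: (fintype.splitP u) => [k Eu|k Eu];
    case: (fintype.splitP v) => [l Ev|l Ev] E.
  + by apply: val_inj; rewrite /= Eu Ev (enum_val_inj E).
  + by case: (A1 (cast_ord cC l)); rewrite -E.
  + by case: (A1 (cast_ord cC k)); rewrite E.
  + by apply: val_inj; rewrite /= Eu Ev; have /cast_ord_inj-> := enum_val_inj E.
- by move=> k; rewrite sl.
Qed.

(** * The variety of a joint part *)

Section JointVariety.
Variables (R : realType) (H : completeNormedModType R[i]).
Variable dot : {dot H for Num.conj}.
Hypothesis Hdot : norm_from_dot dot.
Variables (n : nat) (V : 'I_n -> {linear H -> H}).
Hypothesis V_isom : commuting_isometries V.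
Hypothesis V_dim : ~ irreducible_chain (zero_set (annihilator V [set: H])) 2.
Local Notation C := R[i].
Local Notation var := (fun i => mpolyX C (mnm1 i)).

Let V_comm i j x : V i (V j x) = V j (V i x). Proof. by case: V_isom. Qed.

Lemma annihilator_relation i j : i != j ->
  exists2 F, F != 0 & annihilator V [set: H] (biv i j F).
Proof.
move=> ij; apply: coordinates_dependent => //; exact: annihilator_ideal.
Qed.

Variables (z : 'I_n -> C) (E : set H).
Hypothesis sE : closed_subspace E.
Hypothesis E_inv : forall i x, E x -> E (V i x).
Hypothesis E_pure : forall i, z i = 0 -> pure_on (V i) E.
Hypothesis E_scalar : forall i, z i <> 0 -> forall x, E x -> V i x = z i *: x.
Variables (s t : nat) (sigma : 'I_(s + t) -> 'I_n) (tau : 'I_n -> 'I_(s + t)).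
Hypotheses (sigmaK : cancel sigma tau) (tauK : cancel tau sigma).
Hypothesis z_head : forall k, z (sigma (lshift t k)) = 0.
Hypothesis z_tail : forall j, z (sigma (rshift s j)) <> 0.

Let isoV i : isometry_on (V i) setT. Proof. by case: V_isom. Qed.

Let Vs (k : 'I_s) := V (sigma (lshift t k)).
Let J := annihilator Vs E.
Let W := zero_set J.

Let Vs_comm k l x : Vs k (Vs l x) = Vs l (Vs k x). Proof. exact: V_comm. Qed.
Let Vs_inv k x : E x -> E (Vs k x). Proof. exact: E_inv. Qed.
Let iJ : is_ideal J. Proof. exact: annihilator_ideal. Qed.

Lemma apply_pull_glue p x : E x ->
  poly_apply V p x = poly_apply Vs (pull_glue tau z p) x.
Proof.
move: p x; elim/mpoly_gen_ind => [a x Ex|i x Ex|p q IHp IHq x Ex|p q IHp IHq x Ex].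
- by rewrite pull_glueC !poly_apply_const.
- rewrite pull_glueX poly_apply_var; case: fintype.splitP => k Ek.
    by rewrite poly_apply_var /Vs; congr (V _ x); rewrite -[LHS]tauK; congr sigma;
      apply: val_inj.
  rewrite poly_apply_const; apply: E_scalar => //; rewrite -(tauK i).
  by rewrite (_ : tau i = rshift s k); [exact: z_tail|exact: val_inj].
- by rewrite rmorphD !poly_applyD IHp // IHq.
- rewrite rmorphM /= (poly_applyM V_comm) (poly_applyM Vs_comm) IHq // IHp //.
  exact: poly_apply_invariant.
Qed.

Lemma apply_pull_head q x : poly_apply Vs q x = poly_apply V (pull_head C sigma q) x.
Proof.
move: q x; elim/mpoly_gen_ind => [a x|i x|p q IHp IHq x|p q IHp IHq x].
- by rewrite pull_headC !poly_apply_const.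
- by rewrite pull_headX !poly_apply_var.
- by rewrite rmorphD !poly_applyD IHp IHq.
- by rewrite rmorphM /= (poly_applyM V_comm) (poly_applyM Vs_comm) IHq IHp.
Qed.

Lemma joint_variety_product :
  [set x \o sigma | x in zero_set (annihilator V E)] =
    times_point W (z \o sigma \o @rshift s t).
Proof.
apply/seteqP; split=> [_ [x xZ <-]|y [yW yz]].
  split=> [q qJ|j].
    rewrite -[fun _ => _]/(head sigma x) meval_head; apply: xZ => v Ev.
    by rewrite -apply_pull_head; apply: qJ.
  have := xZ (var (sigma (rshift s j)) - mpolyC n (z (sigma (rshift s j)))).
  rewrite rmorphB /= mevalXU mevalC => E0; apply/subr0_eq/E0 => v Ev.
  rewrite poly_applyD poly_apply_var -mpolyCN poly_apply_const.
  by rewrite E_scalar // scaleNr subrr.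
exists (y \o tau); last by apply/funext => u; rewrite /= sigmaK.
move=> p pE; have -> : y \o tau = glue tau z (fun k => y (lshift t k)).
  apply/funext => i; rewrite /glue /=; case: fintype.splitP => k Ek.
    by congr y; apply: val_inj.
  have -> : tau i = rshift s k by exact: val_inj.
  by rewrite yz /= -[in RHS](tauK i) (_ : tau i = rshift s k) //; apply: val_inj.
rewrite meval_glue; apply: yW => v Ev.
by rewrite -apply_pull_glue //; apply: pE.
Qed.

Lemma joint_variety_distinguished : distinguished_variety W.
Proof.
split; first by exists J.
move=> x xW.
have reg k l : [\/ `|x k| < 1 /\ `|x l| < 1, `|x k| = 1 /\ `|x l| = 1 |
    1 < `|x k| /\ 1 < `|x l|].
  have [->|kl] := eqVneq l k.
    have [x1|x1|x1] := real_ltgtP (normr_real (x k)) (real1 _).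
    - by constructor 1.
    - by constructor 3.
    - by constructor 2.
  set i := sigma (lshift t k); set j := sigma (lshift t l).
  have ij : i != j.
    apply: contraNneq kl => /(can_inj sigmaK)/lshift_inj-> //.
  have [F F0 FV] := annihilator_relation ij.
  apply: (pair_regions Hdot (act := pair_of V i j) (K := E) (h := F)) => //.
  - exact: pair_of_action.
  - have -> : (pair_of V i j 'X%:P : H -> H) = V i by apply/funext => v; apply: pair_ofX.
    exact/E_pure/z_head.
  - have -> : (pair_of V i j 'X : H -> H) = V j by apply/funext => v; apply: pair_ofY.
    exact/E_pure/z_head.
  - by move=> G v; apply: pair_of_invariant.
  - by move=> v _; apply: pair_of_kills.
  - move=> G GE; have := xW (biv k l G); rewrite meval_biv; apply=> v Ev.
    rewrite apply_pull_head -(GE v Ev) pair_ofE; congr (poly_apply V _ v).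
    elim/poly_ind: G {GE} => [|G g IHG]; first by rewrite !rmorph0.
    rewrite !(rmorphD, rmorphM) /= IHG !biv_Y pull_headX; congr (_ * _ + _).
    elim/poly_ind: g => [|g c IHg]; first by rewrite !rmorph0.
    by rewrite !(rmorphD, rmorphM) /= IHg !biv_X !biv_C pull_headX pull_headC.
have [[k0 _]|noI] := pselect (exists k0 : 'I_s, True); last first.
  by left; left => k; case: noI; exists k.
have [x1|x1|x1] := real_ltgtP (normr_real (x k0)) (real1 _).
- by left; left => l; have [[]|[E1]|[E1]] := reg k0 l => //;
    move: x1; rewrite ?E1 ?ltxx // => /lt_trans/(_ E1); rewrite ltxx.
- by right => l; have [[E1]|[E1]|[]] := reg k0 l => //;
    move: x1; rewrite ?E1 ?ltxx // => /lt_trans/(_ E1); rewrite ltxx.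
- by left; right => l; have [[E1]|[]|[E1]] := reg k0 l => //;
    move: E1; rewrite x1 ltxx.
Qed.

(** Every component has a second point since the shifts have no eigenvectors,
    and a chain of length 2 would embed in the variety of the whole tuple. *)
Lemma joint_variety_pure : (0 < s)%N -> has_pure_dimension W 1.
Proof.
move=> s0 Y [Yirr YW Ymax]; split; last first.
  move=> ch; apply: V_dim; apply: (glue_chain (z := z) sigmaK _ ch).
  move=> w /YW wW p pV; rewrite meval_glue; apply: wW => v Ev.
  by rewrite -apply_pull_glue //; apply: pV.
have [_ [y Yy] _] := Yirr.
have Yy' : Y <> [set y].
  move=> Yy'; pose k : 'I_s := Ordinal s0.
  apply: (@not_isolated_point _ _ J y k iJ (YW _ Yy)); last by rewrite -Yy'; split.
  move=> f Jf x Ex; have := Jf x Ex; rewrite (poly_applyM Vs_comm).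
  set u := poly_apply Vs f x; have Eu : E u by apply: poly_apply_invariant.
  rewrite poly_applyD poly_apply_var -mpolyCN poly_apply_const scaleNr => /subr0_eq Vu.
  exact: (pure_no_eigenvector sE (isoV _) (E_pure (z_head k)) Eu Vu).
exists (fun d => if d is 0%N then [set y] else Y); split.
  move=> [|d] _; split=> //; first exact: singleton_irreducible.
  by move=> _ ->.
move=> [|//] _; split; first by move=> _ ->.
by move=> Yy1; apply: Yy'; apply/seteqP; split=> // _ ->.
Qed.

End JointVariety.
Theorem theorem5p4 (R : realType) (H : completeNormedModType R[i])
    (dot : {dot H for Num.conj}) (Hdot : norm_from_dot dot)
    (n : nat) (V : 'I_n -> {linear H -> H})
    (V_isom : commuting_isometries V)
    (V_cnu : completely_non_unitary dot V)
    (V_dim : has_dimension (zero_set (annihilator V [set: H])) 1) :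
  exists (F : set ('I_n -> R[i])) (E : ('I_n -> R[i]) -> set H),
    [/\ forall z, F z -> forall i, z i = 0 \/ `|z i| = 1,
        forall z, F z -> tuple_reducing dot V (E z) /\ E z <> [set 0],
        orthogonal_direct_sum dot F E &
        forall z, F z ->
          (forall i,
             (z i = 0 -> shift_on (V i) (E z)) /\
             (z i <> 0 -> forall x, E z x -> V i x - z i *: x = 0)) /\
          (forall s : nat, #|[set i | z i == 0]%SET| = s ->
             exists sigma : 'I_(s + (n - s)) -> 'I_n,
               [/\ bijective sigma,
                   forall i : 'I_s, z (sigma (lshift (n - s) i)) = 0,
                   forall j : 'I_(n - s), z (sigma (rshift s j)) <> 0 &
                   exists W : set ('I_s -> R[i]),
                     [/\ distinguished_variety W,
                         has_pure_dimension W 1 &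
                         [set x \o sigma
                           | x in zero_set (annihilator V (E z))] =
                         times_point W (z \o sigma \o @rshift s (n - s))]])].
Proof.
have /choice[S SV] : forall i, exists T, adjoint dot (V i) T.
  exact: adjointable_V.
have [_ nochain] := V_dim.
have V_rel i j : i != j -> exists2 P, P != 0 & annihilator V [set: H] (biv i j P).
  exact: annihilator_relation.
pose E := joint_part dot V.
have sE z : closed_subspace (E z) by exact: joint_part_subspace.
have E_inv z i x : E z x -> E z (V i x).
  by move=> /(joint_part_biinvariant Hdot V_isom SV i)[].
have E_pure z i : z i = 0 -> pure_on (V i) (E z).
  exact: (joint_part_pure Hdot V_isom SV V_cnu V_rel).
have E_scalar z i : z i <> 0 -> forall x, E z x -> V i x = z i *: x.
  by move=> zi x /(_ i I)[/(_ zi)].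
exists [set z | (forall i, z i = 0 \/ `|z i| = 1) /\ E z <> [set 0]], E; split.
- by move=> z [].
- move=> z [_ z0]; split=> //.
  apply: (biinvariant_reducing SV (sE z)); exact: joint_part_biinvariant.
- split; first by move=> z w _ _ zw x y; apply: (joint_parts_orthogonal Hdot V_isom zw).
  apply/seteqP; split=> // x _ K [sK EK].
  pose U := \bigcup_(z in [set z | (forall i, z i = 0 \/ `|z i| = 1) /\ E z <> [set 0]]) E z.
  have UV i u : U u -> U (V i u) /\ U (S i u).
    move=> [z Fz zu]; have [? ?] := joint_part_biinvariant Hdot V_isom SV i zu.
    by split; exists z.
  apply: (orthocomplementK Hdot sK) => w wK.
  have wU : orthocomplement dot U w by move=> u Uu; apply: wK; apply: EK.
  suff -> : w = 0 by rewrite dot0r.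
  apply: contrapT => w0.
  have [||z [z1 [v [vU zv] v0]]] := joint_part_meets Hdot V_isom SV
      (orthocomplement_subspace Hdot U).
  + move=> i u uU; split=> y Uy.
      by rewrite SV; apply: uU; case: (UV i y Uy).
    by rewrite (dotS SV); apply: uU; case: (UV i y Uy).
  + by exists w.
  have Ez : E z <> [set 0] by move=> Ez; apply: v0; have : E z v by []; rewrite Ez.
  by apply: v0; apply: (dot_self_eq0 (dot := dot)); apply: vU; exists z.
- move=> z [z1 z0]; split.
    move=> i; split; last by move=> zi x zx; rewrite (E_scalar z i zi x zx) subrr.
    move=> zi; split; first by move=> x _; case: V_isom => iso _; apply: iso.
    apply/seteqP; split=> [x xV|_ -> k _].
      by apply: (E_pure z i zi) => k; have [y Ey <-] := xV k I; exists y.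
    exists 0; first exact: subspace0.
    by elim: k => //= k ->; rewrite linear0.
  move=> s zs; have [sigma [sigma_bij sh st]] := sort_zeros zs.
  exists sigma; split=> //; have [tau sK tK] := sigma_bij.
  exists (zero_set (annihilator (fun k => V (sigma (lshift (n - s) k))) (E z))); split.
  + exact: (joint_variety_distinguished Hdot V_isom nochain (sE z) (@E_inv z) (@E_pure z)
      sK sh).
  + have s0 : (0 < s)%N.
      have [i zi] := joint_part_nonunitary Hdot V_isom SV V_cnu z0.
      by rewrite -zs card_gt0; apply/finset.set0Pn; exists i; rewrite finset.inE zi.
    exact: (joint_variety_pure V_isom nochain (sE z) (@E_inv z) (@E_pure z) (@E_scalar z)
      sK tK sh st s0).
  + exact: (joint_variety_product V_isom (sE z) (@E_inv z) (@E_scalar z) sK tK st).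
Qed.
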